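(* Consider the scaled Markov-modulated infinite-server queue (Model I or Model II) with identical service rates $\mu_i=\mu>0$ for all $i\in\{1,\dots,d\}$ and scaling exponent $\alpha>0$. Let $\gamma:=\max\{1-\alpha/2,\,1/2\}$. As $N\to\infty$ the random variable $$\frac{M^{(N)}-N\varrho}{N^\gamma}$$ converges in distribution to a Normal distribution with zero mean and variance $$\sigma^2:=\sigma_m^2 1_{\{\alpha\le 1\}}+\varrho\,1_{\{\alpha\ge 1\}},\qquad \sigma_m^2:=\mu^{-1}U.$$
   Context: Background process: $J=(J(t))$ is an irreducible continuous-time Markov process on $\{1,\dots,d\}$ with transition rate matrix $Q=(q_{ij})$, unique stationary distribution $\boldsymbol\pi=(\pi_1,\dots,\pi_d)^{\rm T}$ (column vector), and transition probabilities $p_{ij}(t)=\mathbb P(J(t)=j\mid J(0)=i)$. The deviation matrix $D$ of $J$ is $[D]_{ij}:=\int_0^\infty (p_{ij}(t)-\pi_j)\,{\rm d}t$. Queue: while $J(t)=i$, jobs arrive according to a Poisson process with rate $\lambda_i\ge 0$. All jobs are served in parallel, starting immediately on arrival, and leave when service is completed; $J$ evolves independently of the queue. In Model I every job present at time $t$ is subject to a departure hazard rate $\mu_{J(t)}$; in Model II a job arriving while the background process is in state $i$ has an exponential service time with mean $\mu_i^{-1}$. When $\mu_i=\mu$ for all $i$ the two models coincide (service times are i.i.d. exponential with mean $\mu^{-1}$, independent of the rest). Scaling: for $N\in\mathbb N$ and fixed $\alpha>0$, replace $\lambda_i$ by $N\lambda_i$ and $q_{ij}$ by $N^\alpha q_{ij}$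 (service rates unchanged). $M^{(N)}$ denotes the stationary number of jobs in the resulting system (a random variable with the steady-state distribution of the number of jobs present). Notation (in terms of the unscaled parameters): $\Lambda={\rm diag}(\lambda_1,\dots,\lambda_d)$, $\boldsymbol 1$ is the all-ones column vector, $\lambda_\infty:=\sum_{i=1}^d\pi_i\lambda_i$, $\varrho:=\lambda_\infty/\mu$, and $U:=\boldsymbol\pi^{\rm T}\Lambda D\Lambda\boldsymbol 1$. Normal distributions may be degenerate. *)

(* Defs.v *)
From HB Require Import structures.
From mathcomp Require Import all_boot all_order all_algebra.
From mathcomp Require Import all_classical all_reals all_analysis.

Set Implicit Arguments.
Unset Strict Implicit.
Unset Printing Implicit Defensive.

Import Order.TTheory GRing.Theory Num.Theory.
Import numFieldNormedType.Exports.

Local Open Scope classical_set_scope.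
Local Open Scope ring_scope.

(** Time-homogeneous continuous-time Markov processes with values in a
    countable set [S] and transition rate matrix [G] (diagonal included, so
    that [G x x] is minus the total rate out of [x]).  [mp_law x] is the law of
    the process started in [x]; only times [t >= 0] are meaningful.  [mp_rates]
    says that [G] is the right derivative at 0 of the transition function. *)
Record markov_process (R : realType) (S : countType) (G : S -> S -> R) := {
  mp_display : measure_display;
  mp_space : measurableType mp_display;
  mp_path :> R -> mp_space -> S;
  mp_law : S -> probability mp_space R;
  mp_measurable : forall (t : R) (x : S), 0 <= t ->
    measurable (mp_path t @^-1` [set x]);
  mp_start : forall x : S, mp_law x (mp_path 0 @^-1` [set x]) = 1%E;
  mp_markov : forall (x : S) (n : nat) (t : nat -> R) (y : nat -> S)
      (s : R) (z : S),
    0 <= t 0%N -> (forall k, (k < n)%N -> t k <= t k.+1) -> 0 <= s ->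
    let past := \bigcap_(k in [set k | (k <= n)%N])
                  (mp_path (t k) @^-1` [set y k]) in
    mp_law x (past `&` mp_path (t n + s) @^-1` [set z])
    = (mp_law x past * mp_law (y n) (mp_path s @^-1` [set z]))%E;
  mp_rates : forall x y : S,
    (fine (mp_law x (mp_path h @^-1` [set y])) - (x == y)%:R) / h
      @[h --> 0^'+] --> G x y
}.

Section MarkovProcesses.
Context {R : realType} {S : countType} {G : S -> S -> R}.
Implicit Types (X : markov_process G) (nu : S -> R).

Definition transition_prob X (t : R) (x y : S) : R :=
  fine (mp_law X x (X t @^-1` [set y])).

Definition irreducible_process X : Prop :=
  forall x y : S, exists2 t : R, 0 <= t & 0 < transition_prob X t x y.

Definition stationary_distribution X nu : Prop :=
  [/\ forall x, 0 <= nu x,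
      (\esum_(x in [set: S]) (nu x)%:E = 1)%E
    & forall (t : R) (y : S), 0 <= t ->
      (\esum_(x in [set: S]) (nu x * transition_prob X t x y)%:E
       = (nu y)%:E)%E].

End MarkovProcesses.

(** [M] has the steady-state distribution of the functional [jobs] of the
    Markov process with rate matrix [G]. *)
Definition steady_state_of (R : realType) (S : countType) (G : S -> S -> R)
    (jobs : S -> nat) (d : measure_display) (T : measurableType d)
    (P : probability T R) (M : {RV P >-> nat}) : Prop :=
  exists (X : markov_process G) (nu : S -> R),
    stationary_distribution X nu /\
    forall n : nat, P (M @^-1` [set n])
      = (\esum_(x in [set x | jobs x = n]) (nu x)%:E)%E.

Section Queue.
Context {R : realType} {d : nat}.
Variables (Q : 'M[R]_d) (lambda mu : 'rV[R]_d).

(** Model I: the state is (background state, number of jobs).  The term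
    [m %:R * mu 0 i] vanishes for [m = 0], so no departure occurs from an empty
    system; the subtracted indicators make up the diagonal. *)
Definition rates_I (x y : 'I_d * nat) : R :=
  let: (i, m) := x in let: (j, n) := y in
  Q i j * (n == m)%:R
  + (i == j)%:R * (lambda 0 i * ((n == m.+1)%:R - (n == m)%:R)
                   + m%:R * mu 0 i * ((n.+1 == m)%:R - (n == m)%:R)).

Definition add_job (m : {ffun 'I_d -> nat}) (k : 'I_d) : {ffun 'I_d -> nat} :=
  [ffun l => (m l + (l == k))%N].

(** Model II: the state is (background state, m), with [m k] the number of
    present jobs that arrived while the background state was [k]; service
    times being exponential, each of these leaves at rate [mu 0 k] whatever
    the current background state. *)
Definition rates_II (x y : 'I_d * {ffun 'I_d -> nat}) : R :=
  let: (i, m) := x in let: (j, n) := y in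
  Q i j * (n == m)%:R
  + (i == j)%:R *
    (lambda 0 i * ((n == add_job m i)%:R - (n == m)%:R)
     + \sum_(k < d) (m k)%:R * mu 0 k
                    * ((add_job n k == m)%:R - (n == m)%:R)).

End Queue.

Inductive queue_model := Model_I | Model_II.

Definition stationary_number_of_jobs (R : realType) (d : nat)
    (model : queue_model) (Q : 'M[R]_d) (lambda mu : 'rV[R]_d)
    (dT : measure_display) (T : measurableType dT) (P : probability T R)
    (M : {RV P >-> nat}) : Prop :=
  match model with
  | Model_I =>
      steady_state_of (rates_I Q lambda mu) (fun x => x.2) M
  | Model_II =>
      steady_state_of (rates_II Q lambda mu) (fun x => \sum_(k < d) x.2 k)%N M
  end.

Definition deviation_matrix (R : realType) (d : nat) (Q : 'M[R]_d)
    (J : markov_process (fun i j : 'I_d => Q i j)) (varpi : 'cV[R]_d)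
    : 'M[R]_d :=
  \matrix_(i, j) \int[lebesgue_measure]_(t in `[0, +oo[)
                   (transition_prob J t i j - varpi j 0).

(** The library's [normal_prob m 0] is the uniform law on [0, 1], hence the
    separate degenerate case. *)
Definition normal_law (R : realType) (m v : R) : set R -> \bar R :=
  if v == 0 then dirac m else normal_prob m (Num.sqrt v).

(** Convergence in distribution of [X n], each on its own probability space,
    to the law [nu]. *)
Definition cvg_in_distribution (R : realType) (dT : nat -> measure_display)
    (T : forall n, measurableType (dT n)) (P : forall n, probability (T n) R)
    (X : forall n, T n -> R) (nu : set R -> \bar R) : Prop :=
  forall f : R -> R, continuous f -> (exists K, forall x, `|f x| <= K) ->
    (\int[P n]_(w in [set: T n]) (f (X n w))%:E)%E @[n --> \oo]
      --> (\int[nu]_(x in [set: R]) (f x)%:E)%E.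

(* Main.v *)
Require Import Defs.
From HB Require Import structures.
From mathcomp Require Import all_boot all_order all_algebra.
From mathcomp Require Import all_classical all_reals all_analysis.
From mathcomp Require Import measurable_realfun.
From mathcomp Require Import ring lra.

Set Implicit Arguments.
Unset Strict Implicit.
Unset Printing Implicit Defensive.

Import Order.TTheory GRing.Theory Num.Theory.
Import numFieldNormedType.Exports.

Local Open Scope classical_set_scope.
Local Open Scope ring_scope.

(** The number of jobs moves by unit jumps on top of the background process, so
    that the limit law can be read off from the generator of the pair
    (background state, number of jobs), without solving any equation for
    generating functions.

    _Balance_.  Let [p i k] be the stationary weight of background state [i] with
    [k] jobs.  With identical service rates both models have the same generator
    [jobs_generator] on functions of this pair.  Stationarity for small times
    gives that [p] is sub-invariant ([stationary_level_weights]).  Testing this on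
    the levels below [n] bounds the weight of level [n] by a Poisson weight, which
    upgrades sub-invariance to [E (jobs_generator F) = 0] for all [F] of quadratic
    growth ([jobs_balance]).

    _Averaging_.  Put [x = (k - N rho) / N^gamma] and apply balance to a smooth
    function [h x].  The first order term of the generator contains the centred
    arrival rate [lambda_i - lambda_infty], which is compensated by adding
    correctors.  They are solutions [u] of Poisson equations
    [Q u = varpi f - f], and these are given by the deviation matrix [D]
    ([poisson_equation]), because [Q] times the integrand of [D] is the derivative
    of the transition probabilities, and these converge exponentially fast
    ([exponential_ergodicity]).  What remains ([generator_approx]) is
    [E (- mu x h' x + s_N h'' x) = o(1)], with
    [s_N = N^(1 - 2 gamma) lambda_infty + N^(2 - alpha - 2 gamma) U].  The choice
    of [gamma] makes the larger of the two powers of [N] equal to 1, hence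
    [s_N / mu] tends to [sigma2].

    _Identification of the limit_.  For [h = x^2 / 2] this bounds second moments,
    with limit at most [sigma2]; in particular [0 <= sigma2], and the laws
    concentrate at 0 if [sigma2 = 0].  If [0 < sigma2], Stein's equation
    [sigma2 g' x - x g x = f x] has for every Lipschitz, compactly supported [f]
    with mean 0 under the normal law a compactly supported solution [g] with
    Lipschitz derivative ([stein_solution]).  Taking [h' = g] shows that the
    expectation of such an [f] tends to 0.  A cutoff argument ([gaussian_limit])
    extends this to bounded Lipschitz functions, and an approximation of
    continuous functions by Lipschitz functions from below
    ([cvg_in_distribution_of_lipschitz]) concludes. *)

(** * Limits of sums and elementary real analysis *)

Lemma cvg_sumr (R : realType) (T I : Type) (F : set_system T) (r : seq I)
    (P : pred I) (f : I -> T -> R) (l : I -> R) : Filter F ->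
  (forall i, P i -> f i x @[x --> F] --> l i) ->
  \sum_(i <- r | P i) f i x @[x --> F] --> \sum_(i <- r | P i) l i.
Proof. by move=> FF; apply: cvg_big; exact: add_continuous. Qed.

Lemma fsbigT_fin (R : realType) (T : finType) (f : T -> \bar R) :
  (\sum_(i \in [set: T]) f i = \sum_i f i)%E.
Proof.
rewrite (fsbig_seq _ _ (index_enum_uniq T)).
rewrite (_ : [set: T] = [set` index_enum T])//.
by apply/seteqP; split=> i _ //=; rewrite mem_index_enum.
Qed.

Lemma is_derive_continuous (R : realType) (f : R -> R) (x df : R) :
  is_derive x 1 f df -> {for x, continuous f}.
Proof.
by move=> [df' _]; apply: differentiable_continuous; apply/derivable1_diffP.
Qed.

Lemma lipschitz_continuous (R : realType) (k : R -> R) (L : R) :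
  (forall x y, `|k x - k y| <= L * `|x - y|) -> continuous k.
Proof.
move=> lip x; apply/subr_cvg0/norm_cvg0P.
have cv : L * `|y - x| @[y --> x] --> (0 : R).
  have : L * `|y - x| @[y --> x] --> L * `|x - x|.
    apply: cvgMl_tmp; apply: cvg_norm.
    by apply: cvgB; [exact: cvg_id|exact: cvg_cst].
  by rewrite subrr normr0 mulr0.
apply: (squeeze_cvgr _ (cvg_cst 0) cv); apply: nearW => y.
by rewrite normr_ge0 lip.
Qed.

(** The mean value theorem on [x, x + t] or [x + t, x] according to the sign
    of [t], in the form used for jumps in both directions. *)
Lemma MVT_shift (R : realType) (F G : R -> R) (x t : R) :
  (forall y : R, is_derive y 1 F (G y)) ->
  exists2 s, `|s| <= `|t| & F (x + t) - F x = G (x + s) * t.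
Proof.
move=> dF.
have cF a b : {within `[a, b], continuous F}.
  by apply: continuous_subspaceT => y; exact: is_derive_continuous (dF y).
have [t0|t0] := leP 0 t.
  have [|c] := @MVT_segment R F G x (x + t) _ (fun y _ => dF y) (cF _ _).
    by rewrite lerDl.
  rewrite in_itv /= => /andP[xc cxt] E.
  exists (c - x); last by rewrite (addrC x (c - x)) subrK E; congr (_ * _); ring.
  by rewrite !ger0_norm ?subr_ge0// lerBlDr addrC.
have [|c] := @MVT_segment R F G (x + t) x _ (fun y _ => dF y) (cF _ _).
  by rewrite gerDl ltW.
rewrite in_itv /= => /andP[xtc cx] E.
exists (c - x); last first.
  by rewrite (addrC x (c - x)) subrK -opprB E; ring.
rewrite (ltr0_norm t0) ler0_norm ?subr_le0// opprB lerBlDr -lerBlDl opprK.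
by move: xtc; rewrite addrC => ?; lra.
Qed.

(** * Balance equations for a modulated birth-death weight *)

Section JobsGenerator.
Context {R : realType} {d : nat}.
Variables (Q : 'M[R]_d) (lam : 'rV[R]_d) (mu : R).

(** Generator of the pair (background state, number of jobs) when all service
    rates equal [mu].  At [k = 0] the value [k.-1 = 0] is harmless because the
    departure rate [k%:R * mu] vanishes. *)
Definition jobs_generator (F : 'I_d -> nat -> R) (i : 'I_d) (k : nat) : R :=
  \sum_j Q i j * F j k + lam 0 i * (F i k.+1 - F i k)
  + k%:R * mu * (F i k.-1 - F i k).

Definition weighted_sum (p : 'I_d -> nat -> R) n (F : 'I_d -> nat -> R) : R :=
  \sum_(k < n) \sum_i p i k * F i k.

Definition cut n (F : 'I_d -> nat -> R) i k : R := (k <= n)%N%:R * F i k.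

Lemma cut_gt n F i k : (n < k)%N -> cut n F i k = 0.
Proof. by rewrite /cut ltnNge => /negbTE ->; rewrite mul0r. Qed.

Lemma jobs_generatorB F G i k :
  jobs_generator (fun i k => F i k - G i k) i k =
  jobs_generator F i k - jobs_generator G i k.
Proof.
rewrite /jobs_generator.
under eq_bigr do rewrite mulrBr.
by rewrite sumrB; ring.
Qed.

Lemma jobs_generatorZ c F i k :
  jobs_generator (fun i k => c * F i k) i k = c * jobs_generator F i k.
Proof.
rewrite /jobs_generator.
under eq_bigr do rewrite mulrCA.
by rewrite -mulr_sumr; ring.
Qed.

Lemma jobs_generator_gt F n i k : (forall j l, (n < l)%N -> F j l = 0) ->
  (n.+1 < k)%N -> jobs_generator F i k = 0.
Proof.
move=> F0 nk; rewrite /jobs_generator big1 => [|j _]; last first.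
  by rewrite F0 ?mulr0// ltnW.
case: k nk => // k nk; rewrite /= !F0 ?subrr ?mulr0 ?addr0//.
- exact: ltnW.
- exact/ltnW/ltnW.
Qed.

Lemma weighted_sumB p n F G :
  weighted_sum p n (fun i k => F i k - G i k) =
  weighted_sum p n F - weighted_sum p n G.
Proof.
rewrite /weighted_sum -sumrB; apply: eq_bigr => k _.
by rewrite -sumrB; apply: eq_bigr => i _; rewrite mulrBr.
Qed.

Lemma weighted_sumZ p n c F :
  weighted_sum p n (fun i k => c * F i k) = c * weighted_sum p n F.
Proof.
rewrite /weighted_sum mulr_sumr; apply: eq_bigr => k _.
by rewrite mulr_sumr; apply: eq_bigr => i _; rewrite mulrCA.
Qed.

Lemma eq_weighted_sum p n F G :
  (forall i k, (k < n)%N -> F i k = G i k) ->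
  weighted_sum p n F = weighted_sum p n G.
Proof.
move=> FG; rewrite /weighted_sum.
by apply: eq_bigr => k _; apply: eq_bigr => i _; rewrite FG.
Qed.

Lemma weighted_sumS p n F :
  weighted_sum p n.+1 F = weighted_sum p n F + \sum_i p i n * F i n.
Proof. by rewrite /weighted_sum big_ord_recr. Qed.

Lemma weighted_sum_widen p n m F : (forall i k, (n <= k)%N -> F i k = 0) ->
  (n <= m)%N -> weighted_sum p m F = weighted_sum p n F.
Proof.
move=> F0 /subnKC <-; elim: (m - n)%N => [|l IH]; first by rewrite addn0.
rewrite addnS weighted_sumS IH big1 ?addr0// => i _.
by rewrite F0 ?mulr0// leq_addr.
Qed.

Lemma ler_weighted_sum p n F G : (forall i k, 0 <= p i k) ->
  (forall i k, F i k <= G i k) -> weighted_sum p n F <= weighted_sum p n G.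
Proof.
move=> p0 FG; apply: ler_sum => k _; apply: ler_sum => i _.
exact: ler_wpM2l.
Qed.

Lemma ler_norm_weighted_sum p n F : (forall i k, 0 <= p i k) ->
  `|weighted_sum p n F| <= weighted_sum p n (fun i k => `|F i k|).
Proof.
move=> p0; apply: le_trans (ler_norm_sum _ _ _) _; apply: ler_sum => k _.
apply: le_trans (ler_norm_sum _ _ _) _; apply: ler_sum => i _.
by rewrite normrM ger0_norm.
Qed.

(** Cutting a test function above level [n] changes its generator only at the
    two levels [n] and [n.+1]: the boundary terms below are the flow of [F]
    upwards out of [n] and downwards out of [n.+1]. *)
Lemma weighted_sum_cut p n F :
  weighted_sum p n.+2 (jobs_generator (cut n F)) =
  weighted_sum p n.+1 (jobs_generator F)
  - \sum_i p i n * (lam 0 i * F i n.+1)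
  + n.+1%:R * mu * \sum_i p i n.+1 * F i n.
Proof.
have E1 i : jobs_generator (cut n F) i n.+1 = n.+1%:R * mu * F i n.
  rewrite /jobs_generator /cut ltnn leqnn ltnNge leqnSn /= big1 => [|j _].
    by rewrite add0r !mul0r subr0 mulr0 add0r subr0 mul1r.
  by rewrite mul0r mulr0.
have E2 i k : (k < n)%N ->
    jobs_generator (cut n F) i k = jobs_generator F i k.
  move=> kn; rewrite /jobs_generator /cut kn (ltnW kn).
  by rewrite (leq_trans (leq_pred _) (ltnW kn)) !mul1r; under eq_bigr do rewrite mul1r.
have E3 i : jobs_generator (cut n F) i n =
    jobs_generator F i n - lam 0 i * F i n.+1.
  rewrite /jobs_generator /cut ltnn leqnn (leq_pred n) /=.
  by under eq_bigr do rewrite mul1r; rewrite !mul1r; ring.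
rewrite !weighted_sumS (@eq_weighted_sum p n _ (jobs_generator F))//.
under eq_bigr do rewrite E3 mulrBr.
rewrite sumrB; under [in X in _ + X = _]eq_bigr do rewrite E1 mulrCA.
by rewrite -mulr_sumr; ring.
Qed.

(** Sub-invariance tested on the finitely supported functions; this inequality
    is all that the limit [h --> 0] in the stationarity equations gives without
    exchanging it with an infinite sum. *)
Definition subinvariant (p : 'I_d -> nat -> R) : Prop :=
  forall (F : 'I_d -> nat -> R) n m, (n <= m)%N ->
    (forall i k, 0 <= F i k) -> (forall i k, (n < k)%N -> F i k = 0) ->
    weighted_sum p m.+1 (jobs_generator F) <= 0.

Hypothesis Q0 : forall i, \sum_j Q i j = 0.
Hypothesis lam0 : forall i, 0 <= lam 0 i.
Hypothesis mu0 : 0 < mu.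
Variable p : 'I_d -> nat -> R.
Hypothesis p0 : forall i k, 0 <= p i k.
Hypothesis p_sub : subinvariant p.

Let q k := \sum_i p i k.
Let q0 k : 0 <= q k. Proof. by apply: sumr_ge0 => i _; exact: p0. Qed.
Let ell := \sum_i lam 0 i.
Let ell0 : 0 <= ell. Proof. by apply: sumr_ge0 => i _; exact: lam0. Qed.
Let lam_ell i : lam 0 i <= ell.
Proof. by rewrite /ell (bigD1 i)//= lerDl sumr_ge0. Qed.

Lemma jobs_generator1 i k : jobs_generator (fun _ _ => 1) i k = 0.
Proof.
rewrite /jobs_generator; under eq_bigr do rewrite mulr1.
by rewrite Q0 subrr !mulr0 !addr0.
Qed.

Lemma weighted_sum_cut1 n :
  weighted_sum p n.+2 (jobs_generator (cut n (fun _ _ => 1))) =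
   n.+1%:R * mu * q n.+1 - \sum_i p i n * lam 0 i.
Proof.
rewrite weighted_sum_cut (@eq_weighted_sum p _ _ (fun _ _ => 0 * 0)); last first.
  by move=> i k _; rewrite jobs_generator1 mulr0.
rewrite weighted_sumZ mul0r; under eq_bigr do rewrite mulr1.
under [X in _ + _ * X]eq_bigr do rewrite mulr1.
by rewrite -/(q _); ring.
Qed.

(** Sub-invariance tested on the indicator of the levels [0, ..., n] only sees
    the flow through the boundary of this set, whence a recursion which makes
    the weight of a level decay like a Poisson weight. *)
Lemma level_weight_rec n : n.+1%:R * mu * q n.+1 <= ell * q n.
Proof.
have : weighted_sum p n.+2 (jobs_generator (cut n (fun _ _ => 1))) <= 0.
  apply: (p_sub (n := n)) => // [i k|i k nk]; rewrite /cut.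
    by rewrite mulr_ge0.
  by rewrite leqNgt nk mul0r.
rewrite weighted_sum_cut1 subr_le0 => /le_trans; apply.
by rewrite mulr_sumr; apply: ler_sum => i _; rewrite mulrC ler_wpM2r.
Qed.

Lemma level_weight_le n : q n <= q 0 * exp_coeff (ell / mu) n.
Proof.
elim: n => [|n IH]; first by rewrite /exp_coeff /= expr0 fact0 divr1 mulr1.
have n1 : (0 : R) < n.+1%:R by rewrite ltr0n.
have nm : 0 < n.+1%:R * mu by rewrite mulr_gt0.
rewrite -(ler_pM2l nm); apply: le_trans (level_weight_rec n) _.
apply: le_trans (ler_wpM2l ell0 IH) _.
rewrite le_eqVlt; apply/orP; left; apply/eqP.
rewrite /exp_coeff /= factS natrM exprS.
have f0 : (n`!)%:R != 0 :> R by rewrite pnatr_eq0 -lt0n fact_gt0.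
move: (gt_eqF n1) (gt_eqF mu0) => /negbT n10 /negbT mu0'.
rewrite invfM; field.
by rewrite f0 mu0' nat1r n10.
Qed.

(** Since [n.+1 ^ 3 <= 8 ^ n], the Poisson-like decay absorbs any cubic factor
    at the price of a larger parameter. *)
Lemma level_weight_cvg0 : (fun n => n.+1%:R ^+ 3 * q n) @ \oo --> (0 : R).
Proof.
have le8 n : (n.+1%:R : R) ^+ 3 <= 8 ^+ n.
  rewrite -(@natrX _ 8) -natrX ler_nat (_ : 8 = 2 ^ 3)%N// -expnM mulnC expnM.
  by rewrite leq_exp2r// ltn_expl.
have : (fun n => q 0 * exp_coeff (8 * (ell / mu)) n) @ \oo --> (q 0 * 0 : R).
  by apply: cvgMl_tmp; exact: cvg_exp_coeff.
rewrite mulr0; apply: (squeeze_cvgr _ (cvg_cst 0)).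
apply: nearW => n; apply/andP; split; first by rewrite mulr_ge0// exprn_ge0.
apply: le_trans (ler_pM _ _ (le8 n) (level_weight_le n)) _; rewrite ?exprn_ge0//.
by move: (ell / mu) => x; rewrite /exp_coeff /= exprMn mulrCA !mulrA.
Qed.

(** Balance from sub-invariance: for a bound [c] of the truncated [F], both
    [c - F] and [c + F] cut at a high level [m] are nonnegative, so that the
    generator mean of [F] is squeezed by that of [c], which is a boundary term
    at level [m] and tends to 0. *)
Lemma jobs_balance_cut F n :
  weighted_sum p n.+2 (jobs_generator (cut n F)) = 0.
Proof.
pose c := \sum_(k < n.+1) \sum_i `|F i k|.
have cF i k : `|cut n F i k| <= c.
  rewrite /cut; case: leqP => [kn|_]; last first.
    by rewrite mul0r normr0; apply: sumr_ge0 => ? _; apply: sumr_ge0.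
  rewrite mul1r /c (bigD1 (Ordinal (kn : (k < n.+1)%N)))//= (bigD1 i)//= -addrA.
  rewrite lerDl addr_ge0 ?sumr_ge0// => ? _; exact: sumr_ge0.
have c0 : 0 <= c by apply: sumr_ge0 => ? _; apply: sumr_ge0.
have key s m : (n <= m)%N -> `|s| = 1 ->
   s * weighted_sum p n.+2 (jobs_generator (cut n F)) <=
   c * (ell * q m).
  move=> nm s1.
  have := @p_sub
    (fun i k => c * cut m (fun _ _ => 1) i k - - s * cut n F i k) m m.+1.
  rewrite (@eq_weighted_sum p _ _ (fun i k =>
    c * jobs_generator (cut m (fun _ _ => 1)) i k -
    - s * jobs_generator (cut n F) i k)); last first.
    by move=> i k _; rewrite jobs_generatorB !jobs_generatorZ.
  rewrite weighted_sumB !weighted_sumZ weighted_sum_cut1.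
  rewrite (@weighted_sum_widen p n.+2 m.+2); last first.
    by rewrite !ltnS.
    move=> i k nk; apply: jobs_generator_gt nk => j l nl.
    by rewrite /cut leqNgt nl mul0r.
  have -> : forall a b w, (c * (a - b) - - s * w <= 0) = (s * w <= c * (b - a)).
    by move=> a b w; rewrite -[LHS]subr_ge0 -[RHS]subr_ge0; congr (0 <= _); ring.
  move=> /(_ _ _ _)/le_trans; apply => //.
  - move=> i k; rewrite mulNr opprK.
    have [km|mk] := leqP k m.
      have -> : cut m (fun _ _ => 1) i k = 1 by rewrite /cut km mul1r.
      rewrite mulr1 -lerBlDr sub0r.
      apply: le_trans (ler_norm _) _.
      by rewrite normrN normrM s1 mul1r cF.
    by rewrite !cut_gt ?(leq_ltn_trans nm)// !mulr0 addr0.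
  - by move=> i k mk; rewrite !cut_gt ?(leq_ltn_trans nm)// !mulr0 subr0.
  - apply: ler_wpM2l => //; rewrite lerBlDr; apply: ler_wpDr.
      by rewrite !mulr_ge0// ltW.
    by rewrite mulr_sumr; apply: ler_sum => i _; rewrite mulrC ler_wpM2r.
have cv : (fun m => c * (ell * q m)) @ \oo --> (0 : R).
  rewrite -(mulr0 c) -(mulr0 ell); apply: cvgMl_tmp; apply: cvgMl_tmp.
  apply: (squeeze_cvgr _ (cvg_cst 0) level_weight_cvg0).
  apply: nearW => m; rewrite q0 /= -[X in X <= _]mul1r ler_wpM2r//.
  by rewrite exprn_ege1// ler1n.
have cvs s : `|s| = 1 -> s * weighted_sum p n.+2 (jobs_generator (cut n F)) <= 0.
  move=> s1; rewrite -(cvg_lim (@Rhausdorff R) cv).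
  apply: limr_ge; first by apply/cvg_ex; exists 0.
  by exists n => // m /= nm; apply: key.
apply/eqP; rewrite eq_le; apply/andP; split.
  by have := cvs 1; rewrite normr1 mul1r; apply.
by have := cvs (-1); rewrite normrN1 mulN1r oppr_le0; apply.
Qed.

(** The boundary terms of [weighted_sum_cut] vanish in the limit because level
    weights decay faster than the cubic growth of [F k] times a rate. *)
Lemma jobs_balance F (C : R) : (forall i k, `|F i k| <= C * k.+1%:R ^+ 2) ->
  (fun n => weighted_sum p n (jobs_generator F)) @ \oo --> (0 : R).
Proof.
move=> FC.
have C0 : forall i : 'I_d, 0 <= C.
  move=> i; have := FC i 0%N; rewrite expr1n mulr1; exact: le_trans.
rewrite -cvg_shiftS.
have -> : (fun n => weighted_sum p n.+1 (jobs_generator F)) =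
  (fun n => \sum_i p i n * (lam 0 i * F i n.+1)
     - n.+1%:R * mu * \sum_i p i n.+1 * F i n).
  apply/funext => n; have := jobs_balance_cut F n.
  rewrite weighted_sum_cut => /eqP; rewrite -addrA addr_eq0 => /eqP ->; ring.
have cvA : (fun n => \sum_i p i n * (lam 0 i * F i n.+1)) @ \oo --> (0 : R).
  have cv : (fun n => ell * C * 4 * (n.+1%:R ^+ 3 * q n)) @ \oo --> (0 : R).
    rewrite -[X in _ --> X](mulr0 (ell * C * 4)).
    apply: cvgMl_tmp; exact: level_weight_cvg0.
  apply/norm_cvg0P; apply: (squeeze_cvgr _ (cvg_cst 0) cv).
  apply: nearW => n; rewrite normr_ge0 /=.
  apply: le_trans (ler_norm_sum _ _ _) _.
  rewrite /q !mulr_sumr; apply: ler_sum => i _.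
  rewrite normrM (ger0_norm (p0 _ _)) normrM (ger0_norm (lam0 _)).
  rewrite [X in _ <= X]mulrA [X in _ <= X]mulrC ler_wpM2l//.
  apply: (@le_trans _ _ (ell * (C * n.+2%:R ^+ 2))); first exact: ler_pM.
  rewrite -!mulrA !ler_wpM2l ?(C0 i)//.
  rewrite -[4]/(4%:R : R) -!natrX -natrM ler_nat.
  rewrite (@leq_trans (2 ^ 2 * n.+1 ^ 2))//.
    by rewrite -expnMn leq_exp2r// mul2n -addnn addSn ltnS leq_addl.
  by rewrite leq_mul// [X in (_ <= X)%N]expnS leq_pmull.
have cvB : (fun n => n.+1%:R * mu * \sum_i p i n.+1 * F i n) @ \oo --> (0 : R); last first.
  by have := cvgB cvA cvB; rewrite subr0; apply.
have cv : (fun n => mu * C * (n.+2%:R ^+ 3 * q n.+1)) @ \oo --> (0 : R).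
  rewrite -[X in _ --> X](mulr0 (mu * C)).
  apply: cvgMl_tmp.
  have := level_weight_cvg0.
  by rewrite -cvg_shiftS.
apply/norm_cvg0P; apply: (squeeze_cvgr _ (cvg_cst 0) cv).
apply: nearW => n; rewrite normr_ge0 /=.
rewrite normrM ger0_norm; last by rewrite mulr_ge0// ltW.
apply: le_trans (ler_wpM2l _ (ler_norm_sum _ _ _)) _.
  by rewrite mulr_ge0// ltW.
rewrite /q !mulr_sumr; apply: ler_sum => i _.
rewrite normrM (ger0_norm (p0 _ _)).
rewrite mulrCA [X in _ <= X]mulrA [X in _ <= X]mulrC ler_wpM2l//.
have mC : 0 <= mu * C by rewrite mulr_ge0// ?(C0 i)// ltW.
apply: (@le_trans _ _ (mu * C * (n.+1%:R * n.+1%:R ^+ 2))).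
  rewrite (_ : mu * C * _ = n.+1%:R * mu * (C * n.+1%:R ^+ 2)); last by ring.
  by rewrite ler_wpM2l// mulr_ge0// ltW.
rewrite ler_wpM2l// -exprS -!natrX ler_nat leq_exp2r//.
Qed.

End JobsGenerator.

(** * Weights on the number of jobs from a stationary law of either model *)

Section StationarySubinvariance.
Context {R : realType} {S : countType} {G : S -> S -> R}.
Variables (X : markov_process G) (nu : S -> R).
Hypothesis nu_stationary : stationary_distribution X nu.

Lemma transition_prob_ge0 t x y : 0 <= transition_prob X t x y.
Proof. by rewrite /transition_prob fine_ge0. Qed.

Lemma stationary_sum_le (C : seq S) t y : uniq C -> 0 <= t ->
  \sum_(x <- C) nu x * transition_prob X t x y <= nu y.
Proof.
move=> uC t0; have [nu0 _ /(_ t y t0) st] := nu_stationary.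
rewrite -lee_fin -st; apply: esum_ge; exists [set` C].
  by split => //; exact: finite_seq.
by rewrite -fsbig_seq// sumEFin.
Qed.

(** Finitely many terms of the stationarity equation give an inequality at each
    time [h]; dividing by [h] and letting [h --> 0^'+] is then a limit of a
    finite sum. *)
Lemma stationary_rates_le0 (C : seq S) y : uniq C -> y \in C ->
  \sum_(x <- C) nu x * G x y <= 0.
Proof.
move=> uC yC.
have cv : (\sum_(x <- C) nu x *
    ((transition_prob X h x y - (x == y)%:R) / h)) @[h --> 0^'+] -->
    \sum_(x <- C) nu x * G x y.
  apply: cvg_sumr => x _; apply: cvgMl_tmp; exact: mp_rates.
rewrite -(cvg_lim (@Rhausdorff R) cv); apply: limr_le.
  by apply/cvg_ex; eexists; exact: cv.
near=> h.
have h0 : 0 < h by near: h; exact: nbhs_right_gt.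
under eq_bigr do rewrite mulrA; rewrite -mulr_suml.
rewrite pmulr_lle0 ?invr_gt0//.
under eq_bigr do rewrite mulrBr.
rewrite sumrB subr_le0 [X in _ <= X](bigD1_seq y)//= eqxx mulr1.
rewrite [X in _ <= _ + X]big1 ?addr0.
  by apply: stationary_sum_le => //; exact: ltW.
by move=> x /negbTE ->; rewrite mulr0.
Unshelve. all: by end_near. Qed.

End StationarySubinvariance.

Lemma sum_seq_pick (R : pzRingType) (T : eqType) (s : seq T) (a : T) (f : T -> R) :
  uniq s -> \sum_(w <- s) (w == a)%:R * f w = (a \in s)%:R * f a.
Proof.
move=> us; have [as_|ans] := boolP (a \in s).
  rewrite (bigD1_seq a)//= eqxx big1 ?addr0// => w /negbTE ->.
  by rewrite mul0r.
rewrite big_seq big1 ?mul0r// => w ws.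
by have [wa|] := eqVneq w a; [rewrite -wa ws in ans|rewrite mul0r].
Qed.

(** Both models have states (background, content), where background and content
    do not jump together, and only finitely many contents have at most [n]
    jobs.  [A_lev] says that the moves of the content, seen through the number
    of jobs [L], are those of a birth-death process with death rate [mu] per
    job; it holds in the second model because all jobs leave at the same rate
    whatever the background state at their arrival. *)
Section ModulatedLevels.
Context {R : realType} {d : nat} {W : countType}.
Variables (Q : 'M[R]_d) (lam : 'rV[R]_d) (mu : R).
Variables (A : 'I_d -> W -> W -> R) (L : W -> nat) (lev : nat -> seq W).

Definition modulated_rates (x y : 'I_d * W) : R :=
  Q x.1 y.1 * (y.2 == x.2)%:R + (x.1 == y.1)%:R * A x.1 x.2 y.2.

Hypothesis lev_uniq : forall n, uniq (lev n).
Hypothesis mem_lev : forall n w, (w \in lev n) = (L w <= n)%N.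
Hypothesis A_lev : forall i m n (f : nat -> R),
  \sum_(w <- lev n) A i m w * f (L w) =
    lam 0 i * ((L m < n)%N%:R * f (L m).+1 - (L m <= n)%N%:R * f (L m))
    + (L m)%:R * mu * (((L m).-1 <= n)%N%:R * f (L m).-1
                       - (L m <= n)%N%:R * f (L m)).

Definition states n : seq ('I_d * W) :=
  [seq (i, w) | i <- index_enum 'I_d, w <- lev n].

Lemma states_uniq n : uniq (states n).
Proof.
apply: allpairs_uniq => //; first exact: index_enum_uniq.
by move=> [? ?] [? ?] _ _ [-> ->].
Qed.

Lemma mem_states n x : (x \in states n) = (L x.2 <= n)%N.
Proof.
rewrite -mem_lev; case: x => i w; apply/allpairsP/idP => /=.
  by move=> [[j v] /= [_ vn [_ ->]]].
by move=> wn; exists (i, w) => /=; rewrite mem_index_enum.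
Qed.

Lemma modulated_rates_jobs_generator n x F :
  \sum_(y <- states n) modulated_rates x y * F y.1 (L y.2) =
  jobs_generator Q lam mu (cut n F) x.1 (L x.2).
Proof.
rewrite big_allpairs_dep /=; case: x => i m /=.
under eq_bigr => j _.
  under eq_bigr => w _ do rewrite /modulated_rates /= mulrDl -mulrA.
  rewrite big_split /= -mulr_sumr.
  rewrite (sum_seq_pick _ (fun w => F j (L w)))// mem_lev.
  over.
rewrite big_split /= /jobs_generator -addrA; congr (_ + _).
rewrite (bigD1 i)//= [X in _ + X]big1 ?addr0; last first.
  move=> j; rewrite eq_sym => /negbTE ij.
  by rewrite big1// => w _; rewrite ij !mul0r.
under eq_bigr do rewrite eqxx mul1r.
by rewrite (A_lev i m n (F i)).
Qed.

Variables (X : markov_process modulated_rates) (nu : 'I_d * W -> R).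
Hypothesis nu_stationary : stationary_distribution X nu.

Definition level_weight i k :=
  \sum_(x <- states k | (L x.2 == k) && (x.1 == i)) nu x.

Lemma level_weight_ge0 i k : 0 <= level_weight i k.
Proof. by apply: sumr_ge0 => x _; case: nu_stationary. Qed.

Lemma level_weight_sum F k :
  \sum_i level_weight i k * F i k =
  \sum_(x <- states k | L x.2 == k) nu x * F x.1 (L x.2).
Proof.
rewrite (partition_big fst predT)//=; apply: eq_bigr => i _.
by rewrite mulr_suml; apply: eq_bigr => x /andP[/eqP -> /eqP ->].
Qed.

Lemma states_sum n F :
  \sum_(x <- states n) nu x * F x.1 (L x.2) = weighted_sum level_weight n.+1 F.
Proof.
elim: n => [|n IH].
  rewrite weighted_sumS {1}/weighted_sum big_ord0 add0r level_weight_sum.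
  rewrite [in RHS]big_seq_cond [in LHS]big_seq_cond; apply: eq_bigl => x.
  by rewrite mem_states leqn0 andbT andbb.
rewrite weighted_sumS -IH level_weight_sum.
rewrite (bigID (fun x => L x.2 == n.+1)) /= addrC; congr (_ + _).
rewrite -big_filter; apply: perm_big; apply: uniq_perm.
- by rewrite filter_uniq// states_uniq.
- exact: states_uniq.
- by move=> x; rewrite mem_filter !mem_states -ltn_neqAle ltnS.
Qed.

Lemma level_weight_subinvariant : subinvariant Q lam mu level_weight.
Proof.
move=> F n m nm F0 Fn.
rewrite -states_sum.
under eq_bigr => x _.
  rewrite (_ : jobs_generator _ _ _ _ _ _ =
    \sum_(y <- states m) modulated_rates x y * F y.1 (L y.2)); last first.
    rewrite modulated_rates_jobs_generator; congr jobs_generator.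
    apply/funext => i; apply/funext => k; rewrite /cut.
    case: leqP => [_|mk]; first by rewrite mul1r.
    by rewrite Fn ?mulr0// (leq_ltn_trans nm).
  rewrite mulr_sumr; over.
rewrite exchange_big /= big_seq; apply: sumr_le0 => y ym.
under eq_bigr do rewrite mulrA; rewrite -mulr_suml.
apply: mulr_le0_ge0 => //.
exact: stationary_rates_le0 nu_stationary _ _ (states_uniq _) ym.
Qed.

Lemma level_weight_esum k :
  (\esum_(x in [set x | L x.2 = k]) (nu x)%:E)%E
  = (\sum_i level_weight i k)%:E.
Proof.
have -> : [set x | L x.2 = k] = [set` [seq x <- states k | L x.2 == k]].
  apply/seteqP; split => x /=; rewrite mem_filter mem_states.
    by move=> ->; rewrite eqxx leqnn.
  by move=> /andP[/eqP].
rewrite esum_fset; last 2 first.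
- exact: finite_seq.
- by move=> x _; rewrite lee_fin; case: nu_stationary.
rewrite -fsbig_seq ?filter_uniq ?states_uniq// sumEFin big_filter; congr EFin.
rewrite (eq_bigr (fun x => nu x * 1)) => [|x _]; last by rewrite mulr1.
rewrite -(level_weight_sum (fun _ _ => 1)).
by apply: eq_bigr => i _; rewrite mulr1.
Qed.

End ModulatedLevels.

Section TwoModels.
Context {R : realType} {d : nat}.
Variables (Q : 'M[R]_d) (lam : 'rV[R]_d) (mu : R).

Let mu_ : 'rV[R]_d := const_mx mu.

Definition moves_I (i : 'I_d) (m n : nat) : R :=
  lam 0 i * ((n == m.+1)%:R - (n == m)%:R)
  + m%:R * mu_ 0 i * ((n.+1 == m)%:R - (n == m)%:R).

Lemma rates_I_modulated : rates_I Q lam mu_ = modulated_rates Q moves_I.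
Proof. by apply/funext => -[i m]; apply/funext => -[j n]. Qed.

Lemma moves_I_lev i m n (f : nat -> R) :
  \sum_(w <- iota 0 n.+1) moves_I i m w * f w =
    lam 0 i * ((m < n)%N%:R * f m.+1 - (m <= n)%N%:R * f m)
    + m%:R * mu * ((m.-1 <= n)%N%:R * f m.-1 - (m <= n)%N%:R * f m).
Proof.
have pick a : \sum_(w <- iota 0 n.+1) (w == a)%:R * f w = (a <= n)%N%:R * f a.
  by rewrite sum_seq_pick ?iota_uniq// mem_iota.
rewrite -!pick -!sumrB !mulr_sumr -big_split /=; apply: eq_bigr => w _.
rewrite /moves_I mxE; case: m => [|m] /=; last by rewrite eqSS; ring.
by rewrite mul0r; ring.
Qed.

Definition total (m : {ffun 'I_d -> nat}) : nat := (\sum_(k < d) m k)%N.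

Definition moves_II (i : 'I_d) (m n : {ffun 'I_d -> nat}) : R :=
  lam 0 i * ((n == add_job m i)%:R - (n == m)%:R)
  + \sum_(k < d) (m k)%:R * mu_ 0 k * ((add_job n k == m)%:R - (n == m)%:R).

Lemma rates_II_modulated : rates_II Q lam mu_ = modulated_rates Q moves_II.
Proof. by apply/funext => -[i m]; apply/funext => -[j n]. Qed.

Definition lev_II n : seq {ffun 'I_d -> nat} :=
  [seq w <- [seq [ffun k => val (g k)] | g : {ffun 'I_d -> 'I_n.+1}]
   | (total w <= n)%N].

Lemma lev_II_uniq n : uniq (lev_II n).
Proof.
rewrite filter_uniq// map_inj_uniq ?enum_uniq// => f g fg.
by apply/ffunP => k; apply/val_inj; have /ffunP/(_ k) := fg; rewrite !ffunE.
Qed.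

Lemma mem_lev_II n w : (w \in lev_II n) = (total w <= n)%N.
Proof.
rewrite mem_filter; have [wn|//] := leqP; rewrite /=.
apply/mapP; exists [ffun k => inord (w k)]; first by rewrite mem_enum.
apply/ffunP => k; rewrite !ffunE inordK// ltnS (leq_trans _ wn)//.
by rewrite /total (bigD1 k)//= leq_addr.
Qed.

Lemma total_add_job m k : total (add_job m k) = (total m).+1.
Proof.
rewrite /total; under eq_bigr do rewrite ffunE.
rewrite big_split /= -addn1; congr addn.
by rewrite (bigD1 k)//= eqxx big1 ?addn0// => l /negbTE ->.
Qed.

(** A departure of type [k] leads from [m] to the unique [w] with
    [add_job w k = m], which exists exactly when the rate [m k] is nonzero;
    summing the rates [m k * mu] over the types yields [total m * mu]. *)
Lemma moves_II_lev i m n (f : nat -> R) :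
  \sum_(w <- lev_II n) moves_II i m w * f (total w) =
    lam 0 i * ((total m < n)%N%:R * f (total m).+1 - (total m <= n)%N%:R * f (total m))
    + (total m)%:R * mu * (((total m).-1 <= n)%N%:R * f (total m).-1
                       - (total m <= n)%N%:R * f (total m)).
Proof.
have pick a : \sum_(w <- lev_II n) (w == a)%:R * f (total w)
    = (total a <= n)%N%:R * f (total a).
  by rewrite (sum_seq_pick _ (fun w => f (total w))) ?lev_II_uniq// mem_lev_II.
have pickD k : (0 < m k)%N ->
    \sum_(w <- lev_II n) (add_job w k == m)%:R * f (total w)
    = ((total m).-1 <= n)%N%:R * f (total m).-1.
  move=> mk0; pose m' : {ffun 'I_d -> nat} := [ffun l => (m l - (l == k))%N].
  have m'K : add_job m' k = m.
    apply/ffunP => l; rewrite !ffunE; have [->|] := eqVneq l k.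
      by rewrite subnK.
    by rewrite subn0 addn0.
  have <- : total m' = (total m).-1 by rewrite -m'K total_add_job.
  rewrite -pick; apply: eq_bigr => w _; congr (_%:R * _).
  congr nat_of_bool; apply/eqP/eqP => [|->//]; move=> wm; apply/ffunP => l.
  by have /ffunP/(_ l) := etrans wm (esym m'K); rewrite !ffunE => /addIn.
transitivity (lam 0 i * (\sum_(w <- lev_II n) (w == add_job m i)%:R * f (total w)
    - \sum_(w <- lev_II n) (w == m)%:R * f (total w))
  + \sum_(k < d) (m k)%:R * mu * (
    \sum_(w <- lev_II n) (add_job w k == m)%:R * f (total w)
    - \sum_(w <- lev_II n) (w == m)%:R * f (total w))).
  rewrite -sumrB mulr_sumr.
  under [X in _ = _ + X]eq_bigr do rewrite -sumrB mulr_sumr.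
  rewrite exchange_big /= -big_split /=; apply: eq_bigr => w _.
  rewrite /moves_II mulrDl mulr_suml; congr (_ + _); first by ring.
  by apply: eq_bigr => k _; rewrite mxE; ring.
rewrite !pick total_add_job; congr (_ + _).
rewrite -mulrA /total natr_sum mulr_suml; apply: eq_bigr => k _.
rewrite -!/(total _); have [->|mk0] := posnP (m k); first by rewrite !mul0r.
by rewrite pickD// mulrA.
Qed.

Lemma stationary_level_weights (model : queue_model)
    (dT : measure_display) (T : measurableType dT) (P : probability T R)
    (M : {RV P >-> nat}) :
  stationary_number_of_jobs model Q lam mu_ M ->
  exists p : 'I_d -> nat -> R,
    [/\ forall i k, 0 <= p i k,
        forall k, P (M @^-1` [set k]) = (\sum_i p i k)%:E
      & subinvariant Q lam mu p].
Proof.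
case: model => /= -[]; rewrite ?rates_I_modulated ?rates_II_modulated.
  move=> X [nu [nuX PM]].
  exists (level_weight id (iota 0 \o succn) nu); split.
  - exact: level_weight_ge0 nuX.
  - move=> k; rewrite PM; apply: (level_weight_esum (L := id) _ _ nuX).
      by move=> n; exact: iota_uniq.
    by move=> n w; rewrite mem_iota.
  - apply: (level_weight_subinvariant _ _ _ nuX) => [n|n w|i m n f].
    + exact: iota_uniq.
    + by rewrite mem_iota.
    + exact: moves_I_lev.
move=> X [nu [nuX PM]].
exists (level_weight total lev_II nu); split.
- exact: level_weight_ge0 nuX.
- move=> k; rewrite PM; apply: (level_weight_esum (L := total) _ _ nuX).
    exact: lev_II_uniq.
  exact: mem_lev_II.
- apply: (level_weight_subinvariant _ _ _ nuX).
  + exact: lev_II_uniq.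
  + exact: mem_lev_II.
  + exact: moves_II_lev.
Qed.

End TwoModels.

(** * Expansion of the generator on corrected test functions *)

Section TestFunctions.
Context {R : realType}.

(** A function with its first two derivatives, given through the Taylor
    remainders they leave, and with quadratic growth. *)
Definition test_function (K C : R) (h h1 h2 : R -> R) : Prop :=
  [/\ forall x t, `|h (x + t) - h x - t * h1 x - t ^+ 2 / 2 * h2 x| <= K * `|t| ^+ 3,
      forall x t, `|h1 (x + t) - h1 x - t * h2 x| <= K * `|t| ^+ 2,
      forall x t, `|h2 (x + t) - h2 x| <= K * `|t|
    & forall x, [/\ `|h x| <= C * (1 + `|x|) ^+ 2,
                    `|h1 x| <= C * (1 + `|x|) ^+ 2
                  & `|h2 x| <= C * (1 + `|x|) ^+ 2]].

Lemma test_function_square : test_function 0 1 (fun x => x ^+ 2 / 2) id (fun=> 1).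
Proof.
have nx x : 0 <= `|x : R| by exact: normr_ge0.
split=> [x t|x t|x t|x].
- by rewrite mul0r normr_le0; apply/eqP; field.
- by rewrite mul0r normr_le0; apply/eqP; ring.
- by rewrite mul0r subrr normr0.
- rewrite !mul1r normrM normrX normr1 [`|2^-1|]ger0_norm//.
  have := nx x; move: `|x| => y y0; split; nra.
Qed.

Lemma test_function_ge0 K C h h1 h2 : test_function K C h h1 h2 -> 0 <= K.
Proof.
by move=> [_ _ /(_ 0 1) + _]; rewrite normr1 mulr1; apply: le_trans.
Qed.

End TestFunctions.

Section GeneratorExpansion.
Context {R : realType} {d : nat}.
Variables (Q : 'M[R]_d) (lam : 'rV[R]_d) (mu : R) (g r : 'I_d -> R) (linf U : R).
Hypothesis Q0 : forall i, \sum_j Q i j = 0.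
Hypothesis Qg : forall i, \sum_j Q i j * g j = linf - lam 0 i.
Hypothesis Qr : forall i,
  \sum_j Q i j * r j = U - g i * (lam 0 i - linf).
Hypothesis lam0 : forall i, 0 <= lam 0 i.
Hypothesis linf0 : 0 <= linf.
Hypothesis mu0 : 0 < mu.
Variables (B ell : R).
Hypothesis gB : forall i, `|g i| <= B.
Hypothesis rB : forall i, `|r i| <= B.
Hypothesis lam_ell : forall i, lam 0 i <= ell.
Hypothesis B0 : 0 <= B.
Hypothesis ell0 : 0 <= ell.

(** Arrival rates are multiplied by [nn], the background speed by [s], and the
    centred number of jobs by [del]. *)
Variables (nn s del : R).
Hypothesis nn0 : 0 < nn.
Hypothesis s0 : 0 < s.
Hypothesis del0 : 0 < del.

Definition scaled_jobs (k : nat) : R := (k%:R - nn * (linf / mu)) * del.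

Let a := nn * del / s.
Let c i := (nn * del ^+ 2 / 2 * g i + nn ^+ 2 * del ^+ 2 / s * r i) / s.
Let x := scaled_jobs.

(** The coefficient of the second derivative after averaging: the Poisson
    fluctuations of arrivals and departures, and the fluctuations of the
    background process. *)
Definition scaled_variance := nn * del ^+ 2 * linf + nn ^+ 2 * del ^+ 2 / s * U.

Variables (h h1 h2 : R -> R).

(** Perturbed test function: the corrector [a * g i * h1] cancels the
    background-dependent drift, the corrector [c i * h2] replaces the
    background-dependent coefficients of [h2] by their stationary means. *)
Definition corrected_test (i : 'I_d) (k : nat) : R :=
  h (x k) + a * g i * h1 (x k) + c i * h2 (x k).

Let R1 y t := h (y + t) - h y - t * h1 y - t ^+ 2 / 2 * h2 y.
Let R2 y t := h1 (y + t) - h1 y - t * h2 y.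
Let R3 y t := h2 (y + t) - h2 y.
Let rem i k t := R1 (x k) t + a * g i * R2 (x k) t + c i * R3 (x k) t.

(** Exact identity: the Taylor remainders are kept in [rem].  The equations
    [Qg] and [Qr] satisfied by [g] and [r] turn all terms in [lam 0 i] of main
    order into [linf] and [U]. *)
Lemma generator_expansion i k :
  jobs_generator (s *: Q) (nn *: lam) mu corrected_test i k =
    - mu * x k * h1 (x k) + scaled_variance * h2 (x k)
    + mu * x k * h2 (x k) * (del / 2 - a * g i)
    + nn * lam 0 i * rem i k del + k%:R * mu * rem i k (- del).
Proof.
have mun : mu != 0 by rewrite gt_eqF.
have sn : s != 0 by rewrite gt_eqF.
have deln : del != 0 by rewrite gt_eqF.
have xS : x k.+1 = x k + del by rewrite /x /scaled_jobs -natr1; ring.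
have xP : (0 < k)%N -> x k.-1 = x k - del.
  case: (k) => // l _; rewrite /x /scaled_jobs /= -natr1; ring.
have kx : k%:R * mu = nn * linf + mu * x k / del.
  by rewrite /x /scaled_jobs; field; rewrite mun deln.
have dep f : k%:R * mu * (f (x k.-1) - f (x k)) =
    k%:R * mu * (f (x k - del) - f (x k)) :> R.
  by have [->|k0] := posnP k; rewrite ?mul0r// xP.
have depF : k%:R * mu * (corrected_test i k.-1 - corrected_test i k) =
   k%:R * mu * ((h (x k - del) - h (x k)) + a * g i * (h1 (x k - del) - h1 (x k))
     + c i * (h2 (x k - del) - h2 (x k))).
  rewrite /corrected_test; transitivity (k%:R * mu * (h (x k.-1) - h (x k))
    + a * g i * (k%:R * mu * (h1 (x k.-1) - h1 (x k)))
    + c i * (k%:R * mu * (h2 (x k.-1) - h2 (x k)))); first by ring.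
  by rewrite !dep; ring.
have QF : \sum_j (s *: Q) i j * corrected_test j k =
    s * (a * h1 (x k) * (linf - lam 0 i)
     + h2 (x k) * (nn * del ^+ 2 / 2 * (linf - lam 0 i)
       + nn ^+ 2 * del ^+ 2 / s * (U - g i * (lam 0 i - linf))) / s).
  rewrite -Qg -Qr; transitivity (s * (h (x k) * \sum_j Q i j
     + a * h1 (x k) * (\sum_j Q i j * g j)
     + h2 (x k) * (nn * del ^+ 2 / 2 * (\sum_j Q i j * g j)
       + nn ^+ 2 * del ^+ 2 / s * \sum_j Q i j * r j) / s)); last first.
    by rewrite Q0 mulr0 add0r.
  rewrite !mulr_sumr -!big_split /= mulr_sumr mulr_suml -!big_split /= mulr_sumr.
  by apply: eq_bigr => j _; rewrite mxE /corrected_test /c; field.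
rewrite /jobs_generator QF depF {1}/corrected_test mxE xS /corrected_test.
rewrite /rem /R1 /R2 /R3 !kx /scaled_variance /a.
(* opaque values, so that the field equation only sees the polynomial part *)
move: (h (x k)) (h1 (x k)) (h2 (x k)) (h (x k + del)) (h1 (x k + del))
  (h2 (x k + del)) (h (x k - del)) (h1 (x k - del)) (h2 (x k - del)) (c i).
by move=> e0 e1 e2 f0 f1 f2 d0 d1 d2 ci; field; rewrite sn deln.
Qed.

Hypothesis nndel2 : nn * del ^+ 2 <= 1.
Hypothesis nn2del2 : nn ^+ 2 * del ^+ 2 / s <= 1.
Hypothesis nndel : 1 <= nn * del.

Definition expansion_const := (ell + linf + mu + mu) * (1 + 3 * B).

Lemma expansion_const_ge0 : 0 <= expansion_const.
Proof. by rewrite mulr_ge0 ?addr_ge0 ?mulr_ge0// ltW. Qed.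

Variables (K C : R).
Hypothesis hP : test_function K C h h1 h2.

Let K0 : 0 <= K. Proof. exact: test_function_ge0 hP. Qed.
Let a0 : 0 <= a. Proof. by rewrite /a ltW// divr_gt0// mulr_gt0. Qed.

(** Both scaled coefficients in [c] are at most 1 by the bounds on [nn * del ^+ 2]
    and [nn ^+ 2 * del ^+ 2 / s]. *)
Lemma c_le i : `|c i| <= 2 * B / s.
Proof.
rewrite /c normrM [`|s^-1|]gtr0_norm ?invr_gt0// ler_pM2r ?invr_gt0//.
have e1 : 0 <= nn * del ^+ 2 / 2 <= 1.
  apply/andP; split.
    by rewrite divr_ge0 ?mulr_ge0 ?(ltW nn0) ?(ltW del0).
  by rewrite ler_pdivrMr// mul1r (le_trans nndel2)// ler1n.
have e2 : 0 <= nn ^+ 2 * del ^+ 2 / s <= 1.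
  by rewrite nn2del2 divr_ge0 ?mulr_ge0 ?(ltW s0) ?(ltW nn0) ?(ltW del0).
move: e1 e2 => /andP[e1 e1'] /andP[e2 e2'].
rewrite (_ : 2 * B = 1 * B + 1 * B); last by ring.
apply: le_trans (ler_normD _ _) _; rewrite !(normrM (_ / _)).
by rewrite (ger0_norm e1) (ger0_norm e2) lerD// ler_pM.
Qed.

Let E := del * (1 + 3 * B) + a * (1 + 3 * B).

Lemma rem_le i k t : `|t| = del -> nn * `|rem i k t| <= K * E.
Proof.
move=> td; have [H1 H2 H3 _] := hP.
have r1 : `|R1 (x k) t| <= K * del ^+ 3 by rewrite -td; exact: H1.
have r2 : `|a * g i * R2 (x k) t| <= a * B * (K * del ^+ 2).
  rewrite normrM ler_pM// -?td; last exact: H2.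
  by rewrite normrM (ger0_norm a0) ler_wpM2l.
have r3 : `|c i * R3 (x k) t| <= 2 * B / s * (K * del).
  by rewrite normrM ler_pM// ?c_le// -td; exact: H3.
have : `|rem i k t| <= K * del ^+ 3 + a * B * (K * del ^+ 2) + 2 * B / s * (K * del).
  apply: le_trans (ler_normD _ _) _; rewrite lerD//.
  exact: le_trans (ler_normD _ _) (lerD r1 r2).
move/(ler_wpM2l (ltW nn0))/le_trans; apply.
rewrite (_ : nn * _ = K * ((nn * del ^+ 2) * (del + a * B) + 2 * B * a)); last first.
  by rewrite /a; field; rewrite gt_eqF.
rewrite ler_wpM2l//.
have aB : 0 <= a * B by rewrite mulr_ge0.
have dB : 0 <= del * B by rewrite mulr_ge0// ltW.
have : nn * del ^+ 2 * (del + a * B) <= del + a * B.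
  by rewrite ler_piMl// addr_ge0// ltW.
rewrite /E; move: (nn * _ * _) => z; have := a0; nra.
Qed.

Lemma departure_rate_le k : k%:R * mu <= nn * (linf + mu * `|x k|).
Proof.
rewrite (_ : k%:R * mu = nn * linf + mu * x k / del); last first.
  by rewrite /x /scaled_jobs; field; rewrite !gt_eqF.
rewrite mulrDr lerD2l; apply: le_trans (ler_norm _) _.
rewrite !normrM (gtr0_norm mu0) [`|del^-1|]gtr0_norm ?invr_gt0//.
rewrite mulrC ler_wpM2r ?mulr_ge0 ?(ltW mu0)//.
by rewrite -[del^-1]mul1r ler_pdivrMr.
Qed.

(** The remainders carry a factor [del] or [a = nn * del / s] once multiplied
    by jump rates of order [nn * (1 + `|x k|)], since [1 / del <= nn]. *)
Lemma generator_approx i k :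
  `|jobs_generator (s *: Q) (nn *: lam) mu corrected_test i k
    - (- mu * (x k * h1 (x k)) + scaled_variance * h2 (x k))|
  <= expansion_const * (del + a) * ((1 + `|x k|) * (K + `|h2 (x k)|)).
Proof.
rewrite generator_expansion.
set y := x k; set v := h2 y; set M := mu * y * v * _.
set P := nn * _ * _; set D := k%:R * mu * _.
rewrite (_ : _ - _ = M + P + D); last by ring.
have E0 : 0 <= E.
  have b3 : 0 <= 1 + 3 * B by have := B0; lra.
  by rewrite /E addr_ge0 ?(mulr_ge0 a0 b3) ?(mulr_ge0 (ltW del0) b3).
have y0 : 0 <= `|y| by exact: normr_ge0.
have v0 : 0 <= `|v| by exact: normr_ge0.
have mM : `|M| <= mu * `|y| * `|v| * E.
  rewrite /M !normrM (gtr0_norm mu0) ler_wpM2l ?mulr_ge0 ?(ltW mu0)//.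
  apply: le_trans (ler_normB _ _) _.
  rewrite (normrM a (g i)) (ger0_norm a0) [`|del / 2|]ger0_norm ?divr_ge0 ?(ltW del0)//.
  rewrite /E; apply: lerD.
    by have := mulr_ge0 (ltW del0) B0; have := del0; lra.
  by rewrite ler_wpM2l//; have := gB i; have := B0; lra.
have mP : `|P| <= ell * (K * E).
  rewrite /P -mulrA mulrCA normrM (ger0_norm (lam0 i)) ler_pM//.
  by rewrite normrM (gtr0_norm nn0) rem_le// gtr0_norm.
have mD : `|D| <= (linf + mu * `|y|) * (K * E).
  rewrite /D normrM ger0_norm ?mulr_ge0 ?(ltW mu0)//.
  apply: le_trans (ler_wpM2r (normr_ge0 _) (departure_rate_le k)) _.
  rewrite -/y -mulrA mulrCA ler_wpM2l//.
    by rewrite addr_ge0// mulr_ge0// ltW.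
  by rewrite rem_le// normrN gtr0_norm.
apply: le_trans (ler_normD _ _) _.
apply: le_trans (lerD (le_trans (ler_normD _ _) (lerD mM mP)) mD) _.
rewrite /expansion_const.
rewrite (_ : _ * (del + a) * _ =
  (ell + linf + mu + mu) * ((1 + `|y|) * (K + `|v|)) * E); last by rewrite /E; ring.
rewrite (_ : mu * _ * _ * E + _ + _ =
  (mu * `|y| * `|v| + (ell + linf + mu * `|y|) * K) * E); last by ring.
rewrite ler_wpM2r//.
have mm := ltW mu0.
have := mulr_ge0 ell0 K0; have := mulr_ge0 linf0 K0; have := mulr_ge0 mm K0.
have := mulr_ge0 mm v0; have := mulr_ge0 mm y0.
have := mulr_ge0 (mulr_ge0 mm y0) v0; have := mulr_ge0 (mulr_ge0 mm y0) K0.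
have := mulr_ge0 (mulr_ge0 ell0 y0) v0; have := mulr_ge0 (mulr_ge0 ell0 y0) K0.
have := mulr_ge0 (mulr_ge0 linf0 y0) v0; have := mulr_ge0 (mulr_ge0 linf0 y0) K0.
have := mulr_ge0 ell0 v0; have := mulr_ge0 linf0 v0.
lra.
Qed.

Lemma corrected_test_growth : 0 <= C -> exists C' : R,
  forall i k, `|corrected_test i k| <= C' * k.+1%:R ^+ 2.
Proof.
move=> C0; have [_ _ _ H] := hP.
pose w := 1 + del + nn * (linf / mu) * del.
have nl0 : 0 <= nn * (linf / mu) * del.
  exact: mulr_ge0 (mulr_ge0 (ltW nn0) (divr_ge0 linf0 (ltW mu0))) (ltW del0).
have w0 : 0 <= w by have := del0; rewrite /w; lra.
exists ((1 + a * B + 2 * B / s) * (C * w ^+ 2)) => i k.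
have xw : 1 + `|x k| <= w * k.+1%:R.
  have : `|x k| <= k%:R * del + nn * (linf / mu) * del.
    rewrite /x /scaled_jobs mulrBl.
    apply: le_trans (ler_normB _ _) _.
    by rewrite (ger0_norm nl0) ger0_norm// mulr_ge0// ltW.
  have k0 : 0 <= k%:R :> R by [].
  have := mulr_ge0 k0 nl0; have := mulr_ge0 k0 (ltW del0).
  rewrite /w -natr1; have := del0; move: (`|x k|) nl0 k0 => X.
  move: (nn * _ * _) => Y; nra.
have hw y : `|y| <= C * (1 + `|x k|) ^+ 2 -> `|y| <= C * w ^+ 2 * k.+1%:R ^+ 2.
  move/le_trans; apply; rewrite -mulrA ler_wpM2l// -exprMn.
  by rewrite lerXn2r ?nnegrE ?addr_ge0 ?mulr_ge0.
have [/hw b0 /hw b1 /hw b2] := H (x k).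
have Z0 : 0 <= C * w ^+ 2 * k.+1%:R ^+ 2 by rewrite !mulr_ge0 ?sqr_ge0.
rewrite /corrected_test.
rewrite (_ : (1 + _ + _) * _ * _ = C * w ^+ 2 * k.+1%:R ^+ 2
  + a * B * (C * w ^+ 2 * k.+1%:R ^+ 2)
  + 2 * B / s * (C * w ^+ 2 * k.+1%:R ^+ 2)); last by ring.
apply: le_trans (ler_normD _ _) _; apply: lerD; last first.
  by rewrite normrM ler_pM// c_le.
apply: le_trans (ler_normD _ _) _; apply: lerD => //.
by rewrite normrM ler_pM// normrM (ger0_norm a0) ler_wpM2l.
Qed.

End GeneratorExpansion.

(** * Exponential ergodicity of the background process *)

Section FiniteMarkovProcess.
Context {R : realType} {d : nat} {Q : 'M[R]_d}.
Variable J : markov_process (fun i j : 'I_d => Q i j).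

Let p (t : R) (i j : 'I_d) := transition_prob J t i j.

Lemma fine_law i E : measurable E -> (fine (mp_law J i E))%:E = mp_law J i E.
Proof. by move=> mE; rewrite fineK// fin_num_measure. Qed.

Lemma law_split i t (E : set (mp_space J)) : 0 <= t -> measurable E ->
  fine (mp_law J i E) =
  \sum_k fine (mp_law J i (E `&` J t @^-1` [set k])).
Proof.
move=> t0 mE; apply: EFin_inj; rewrite fine_law// -sumEFin.
have mEk k : measurable (E `&` J t @^-1` [set k]).
  by apply: measurableI => //; exact: mp_measurable.
under eq_bigr => k _ do rewrite (fine_law _ (mEk k)).
rewrite -fsbigT_fin -measure_fin_bigcup//.
- rewrite -setI_bigcupr; congr (mp_law J i _); apply/seteqP; split=> w /= => [Ew|[]//].
  by split => //; exists (J t w).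
- exact: finite_finset.
- by move=> k l _ _ [w [[_ /= <-] [_ /= <-]]].
Qed.

Lemma sum_transition_prob t i : 0 <= t -> \sum_j p t i j = 1.
Proof.
move=> t0; have := @law_split i t setT t0 measurableT.
rewrite probability_setT /= => ->; apply: eq_bigr => k _.
by rewrite setTI.
Qed.

Lemma transition_prob_le1 t i j : 0 <= t -> p t i j <= 1.
Proof.
move=> t0; rewrite -(sum_transition_prob i t0) (bigD1 j)//= lerDl.
by apply: sumr_ge0 => k _; exact: transition_prob_ge0.
Qed.

Lemma chapman_kolmogorov s t i j : 0 <= s -> 0 <= t ->
  p (s + t) i j = \sum_k p s i k * p t k j.
Proof.
move=> s0 t0; rewrite /p /transition_prob (@law_split _ s)//; last first.
  by apply: mp_measurable; rewrite addr_ge0.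
apply: eq_bigr => k _.
have := @mp_markov _ _ _ J i 0%N (fun=> s) (fun=> k) t j s0.
move=> /(_ _ t0)/=; rewrite (_ : \bigcap_(_ in _) _ = J s @^-1` [set k]).
  rewrite setIC => ->//; rewrite fineM// fin_num_measure//; exact: mp_measurable.
by apply/seteqP; split=> w /=; [move=> /(_ 0%N); apply|move=> ? l _].
Qed.

Lemma transition_prob0 i j : p 0 i j = (i == j)%:R.
Proof.
have pii k : p 0 k k = 1 by rewrite /p /transition_prob mp_start.
have [<-|ij] := eqVneq i j; first exact: pii.
apply/eqP; rewrite eq_le transition_prob_ge0 andbT.
have := sum_transition_prob i (lexx 0).
rewrite (bigD1 i)//= pii (bigD1 j) 1?eq_sym//= => /eqP.
rewrite -[X in _ == X]addr0 (inj_eq (addrI _)) addr_eq0 => /eqP ->.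
by rewrite oppr_le0 sumr_ge0// => k _; exact: transition_prob_ge0.
Qed.

Lemma transition_prob_cvg_delta i j : p h i j @[h --> 0^'+] --> ((i == j)%:R : R).
Proof.
have : h * ((p h i j - (i == j)%:R) / h) + (i == j)%:R @[h --> (0 : R)^'+] -->
    (0 * Q i j + (i == j)%:R : R).
  apply: cvgD; last exact: cvg_cst.
  apply: cvgM; last exact: mp_rates.
  by apply: cvg_at_right_filter; exact: cvg_id.
rewrite mul0r add0r; apply: cvg_trans; apply: near_eq_cvg.
near=> h; have h0 : h != 0 by rewrite gt_eqF//; near: h; exact: nbhs_right_gt.
by rewrite mulrC divfK// subrK.
Unshelve. all: by end_near. Qed.

Lemma rates_row_sum i : \sum_j Q i j = 0.
Proof.
have cv : \sum_j (p h i j - (i == j)%:R) / h @[h --> (0 : R)^'+] --> \sum_j Q i j.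
  by apply: cvg_sumr => j _; exact: mp_rates.
rewrite -(cvg_lim (@Rhausdorff R) cv); apply: (cvg_lim (@Rhausdorff R)).
apply: cvg_near_cst; near=> h.
have h0 : 0 <= h by rewrite ltW//; near: h; exact: nbhs_right_gt.
rewrite -mulr_suml sumrB sum_transition_prob// (bigD1 i)//= eqxx big1.
  by rewrite addr0 subrr mul0r.
by move=> j; rewrite eq_sym => /negbTE ->.
Unshelve. all: by end_near. Qed.

(** [p h j j] tends to 1 at 0, hence is positive for small [h], and
    [p t j j] is at least a power of [p (t / n) j j]. *)
Lemma transition_prob_diag_gt0 t j : 0 <= t -> 0 < p t j j.
Proof.
move=> t0; have : \forall h \near 0^'+, 0 < p h j j.
  have := @transition_prob_cvg_delta j j; rewrite eqxx => /cvgr_gt.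
  by move=> /(_ _ ltr01).
move=> [e /= e0 He].
have H h : 0 <= h -> h < e -> 0 < p h j j.
  rewrite le_eqVlt => /orP[/eqP <- _|h0 he]; first by rewrite transition_prob0 eqxx.
  by apply: He => //=; rewrite sub0r normrN gtr0_norm.
have [n tn] : exists n : nat, t / n.+1%:R < e.
  exists (Num.truncn (t / e)); rewrite ltr_pdivrMr// mulrC -ltr_pdivrMr//.
  exact: truncnS_gt.
have h0 : 0 <= t / n.+1%:R by rewrite divr_ge0.
have pw m : 0 < p (m%:R * (t / n.+1%:R)) j j.
  elim: m => [|m IH]; first by rewrite mul0r transition_prob0 eqxx.
  rewrite -natr1 mulrDl mul1r chapman_kolmogorov//; last by rewrite mulr_ge0.
  rewrite (bigD1 j)//=; apply: ltr_pwDl; first by rewrite mulr_gt0// H.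
  by apply: sumr_ge0 => k _; rewrite mulr_ge0// transition_prob_ge0.
by have := pw n.+1; rewrite mulrC divfK.
Qed.

Hypothesis J_irreducible : irreducible_process J.

(** A common time for all pairs exists because positivity at time [t]
    propagates to later times by waiting in the target state.  The witness
    [eps] is half the product of all entries, which is below each of them. *)
Lemma doeblin_minorization : exists T eps : R,
  [/\ 0 < T, 0 < eps, eps < 1 & forall i j, eps <= p T i j].
Proof.
have /all_sig2[f f0 fP] : forall ij : 'I_d * 'I_d,
    {t : R | 0 <= t & 0 < p t ij.1 ij.2}.
  by move=> ij; apply/cid2/J_irreducible.
pose T := 1 + \sum_ij f ij.
have fT ij : f ij <= T.
  by rewrite /T (bigD1 ij)//= addrCA lerDl addr_ge0// sumr_ge0.
have pT i j : 0 < p T i j.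
  rewrite -(subrK (f (i, j)) T) addrC chapman_kolmogorov//; last by rewrite subr_ge0.
  rewrite (bigD1 j)//=; apply: ltr_pwDl.
    by rewrite mulr_gt0 ?(fP (i, j))// transition_prob_diag_gt0// subr_ge0.
  by apply: sumr_ge0 => k _; rewrite mulr_ge0// transition_prob_ge0.
have T0 : 0 < T by rewrite /T ltr_pwDl// sumr_ge0.
exists T, ((\prod_ij p T ij.1 ij.2) / 2).
have pr0 : 0 < \prod_ij p T ij.1 ij.2 by apply: prodr_gt0 => -[].
have le_prod i j : \prod_ij p T ij.1 ij.2 <= p T i j.
  rewrite (bigD1 (i, j))//= ler_piMr ?transition_prob_ge0// prodr_ile1// => ij _.
  by rewrite transition_prob_ge0/= transition_prob_le1// ltW.
have pr1 : \prod_ij p T ij.1 ij.2 <= 1.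
  by rewrite prodr_ile1// => ij _; rewrite transition_prob_ge0/= transition_prob_le1// ltW.
split => //; first by rewrite divr_gt0.
- by move: pr1; lra.
- by move=> i j; apply: le_trans (le_prod i j); move: pr0; lra.
Qed.

Variable varpi : 'cV[R]_d.
Hypothesis varpi_stationary : stationary_distribution J (fun i => varpi i 0).

Lemma varpi_ge0 i : 0 <= varpi i 0.
Proof. by case: varpi_stationary. Qed.

Let esum_ord (f : 'I_d -> R) : (forall i, 0 <= f i) ->
  (\esum_(i in [set: 'I_d]) (f i)%:E)%E = (\sum_i f i)%:E.
Proof.
move=> f0; rewrite esum_fset//.
- by rewrite fsbigT_fin sumEFin.
- exact: finite_finset.
- by move=> i _; rewrite lee_fin.
Qed.

Lemma sum_varpi : \sum_i varpi i 0 = 1.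
Proof.
have [h0 + _] := varpi_stationary; by rewrite esum_ord// => -[].
Qed.

Lemma varpi_invariant t j : 0 <= t ->
  \sum_i varpi i 0 * p t i j = varpi j 0.
Proof.
move=> t0; have [h0 _ /(_ t j t0)] := varpi_stationary; rewrite esum_ord.
  by case.
by move=> i; rewrite mulr_ge0// transition_prob_ge0.
Qed.

Lemma varpi_le1 i : varpi i 0 <= 1.
Proof.
by rewrite -sum_varpi (bigD1 i)//= lerDl sumr_ge0// => j _; exact: varpi_ge0.
Qed.

(** Doeblin's argument: [p T - eps * varpi] is a nonnegative kernel of mass
    [1 - eps], and subtracting [eps * varpi] does not change the result since
    [varpi] annihilates [p r - varpi]. *)
Lemma geometric_ergodicity T eps : 0 < T -> eps < 1 ->
    (forall i j, eps <= p T i j) -> 0 < eps ->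
  forall n t, 0 <= t -> forall i j,
  `|p (n%:R * T + t) i j - varpi j 0| <= (1 - eps) ^+ n.
Proof.
move=> T0 e1 pT e0; elim=> [|n IH] t t0 i j.
  rewrite mul0r add0r expr0 ler_norml.
  have := transition_prob_ge0 J t i j; have := @transition_prob_le1 t i j t0.
  rewrite -/(p t i j) => h1 h2; have := varpi_ge0 j; have := varpi_le1 j.
  by move=> *; apply/andP; split; lra.
have nTt : 0 <= n%:R * T + t by rewrite addr_ge0// mulr_ge0// ltW.
rewrite -natr1 mulrDl mul1r addrAC addrC chapman_kolmogorov ?(ltW T0)//.
set r := n%:R * T + t in nTt *.
have -> : \sum_k p T i k * p r k j - varpi j 0 =
    \sum_k (p T i k - eps * varpi k 0) * (p r k j - varpi j 0).
  under [RHS]eq_bigr do rewrite mulrBr.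
  rewrite sumrB -[X in _ = _ - X]mulr_suml sumrB sum_transition_prob ?(ltW T0)//.
  rewrite -mulr_sumr sum_varpi.
  under [X in _ = X - _]eq_bigr do rewrite mulrBl -mulrA.
  rewrite sumrB -mulr_sumr varpi_invariant//; ring.
have w0 k : 0 <= p T i k - eps * varpi k 0.
  rewrite subr_ge0; apply: le_trans (pT i k).
  by rewrite ler_piMr ?varpi_le1// ltW.
apply: le_trans (ler_norm_sum _ _ _) _.
apply: (@le_trans _ _ (\sum_k (p T i k - eps * varpi k 0) * (1 - eps) ^+ n)).
  apply: ler_sum => k _; rewrite normrM (ger0_norm (w0 k)) ler_wpM2l//.
  exact: IH.
rewrite -mulr_suml sumrB sum_transition_prob ?(ltW T0)//.
by rewrite -mulr_sumr sum_varpi mulr1 exprS.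
Qed.

Lemma exponential_ergodicity : exists b C : R, [/\ 0 < b, 0 <= C &
  forall t i j, 0 <= t -> `|p t i j - varpi j 0| <= C * expR (- (b * t))].
Proof.
have [T [eps [T0 e0 e1 pT]]] := doeblin_minorization.
have th0 : 0 < 1 - eps by rewrite subr_gt0.
pose b := - ln (1 - eps) / T.
have b0 : 0 < b.
  by rewrite divr_gt0// oppr_gt0 ln_lt0// th0/= gtrBl.
exists b, (1 - eps)^-1; split => //; first by rewrite invr_ge0 ltW.
move=> t i j t0.
pose n := Num.truncn (t / T).
have nT : n%:R * T <= t.
  by rewrite -ler_pdivlMr// truncn_le divr_ge0// ltW.
have tn : t < n.+1%:R * T by rewrite -ltr_pdivrMr// truncnS_gt.
have := @geometric_ergodicity T eps T0 e1 pT e0 n (t - n%:R * T).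
rewrite subr_ge0 => /(_ nT i j); rewrite (addrC (_ * T)) (subrK (n%:R * T) t).
move=> /le_trans; apply.
rewrite -[X in X <= _](mulKf (lt0r_neq0 th0)) -exprS ler_wpM2l ?invr_ge0 ?(ltW th0)//.
rewrite -[X in X ^+ _ <= _](lnK (_ : 1 - eps \is Num.pos)) ?posrE//.
rewrite -expRM_natl ler_expR.
have -> : n.+1%:R * ln (1 - eps) = - (b * (n.+1%:R * T)).
  by rewrite /b; field; rewrite gt_eqF.
by rewrite lerN2 ler_wpM2l// ltW.
Qed.

End FiniteMarkovProcess.

(** * The deviation matrix solves the Poisson equation *)

Lemma exp_decay_cvg0 (R : realType) (b c : R) : 0 < b ->
  c * expR (- (b * t)) @[t --> +oo] --> (0 : R).
Proof.
move=> b0; rewrite -(mulr0 c); apply: cvgMl_tmp.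
apply: (@cvg_comp _ _ _ (fun t => b * t) (fun x => expR (- x)) _ +oo).
  by apply: gt0_cvgMry => //; exact: cvg_id.
exact: cvgr_expR.
Qed.

Section ExponentiallyBoundedIntegrals.
Context {R : realType}.
Notation leb := (@lebesgue_measure R).
Variables (b C : R).
Hypothesis b0 : 0 < b.
Hypothesis C0 : 0 <= C.

Let e (t : R) := C * expR (- (b * t)).
Let Ep (t : R) : R := - (C / b) * expR (- (b * t)).

Let e0 t : 0 <= e t. Proof. by rewrite mulr_ge0// expR_ge0. Qed.

Let dEp (t : R) : is_derive t 1 Ep (e t).
Proof. by apply: is_derive_eq; rewrite /GRing.scale /= /e; field; rewrite gt_eqF. Qed.

Let continuous_exp (c : R) : continuous (fun t : R => c * expR (- (b * t))).
Proof.
by move=> t; apply: is_derive_continuous.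
Qed.

Let within_cvg0 (f : R -> R) : {within `[0, +oo[, continuous f} ->
  f x @[x --> 0^'+] --> f 0.
Proof. by case/continuous_within_itvcyP. Qed.

Let cont_within (f : R -> R) : continuous f -> {within `[0, +oo[, continuous f}.
Proof. by move=> cf; exact: continuous_subspaceT. Qed.

Let int_e : (\int[leb]_(t in `[0%R, +oo[) (e t)%:E = (0 : R)%:E - (Ep 0)%:E)%E.
Proof.
apply: ge0_continuous_FTC2y => //.
- exact/cont_within/continuous_exp.
- exact: exp_decay_cvg0.
- exact/within_cvg0/cont_within/continuous_exp.
- by move=> t _; rewrite derive1E; have [] := dEp t.
Qed.

Let measurable_within (f : R -> R) : {within `[0, +oo[, continuous f} ->
  measurable_fun (`[0, +oo[%classic : set R) f.
Proof.
case/continuous_within_itvcyP => cf _.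
apply/measurable_fun_itv_obnd_cbndP; apply: open_continuous_measurable_fun => //.
exact/in_continuous_mksetP.
Qed.

Let integrable_e : leb.-integrable `[0%R, +oo[ (EFin \o e).
Proof.
apply/integrableP; split.
  apply/measurable_EFinP; apply: measurable_within; apply: cont_within.
  exact: continuous_exp.
under eq_integral do rewrite /= ger0_norm//.
by rewrite int_e -EFinB ltry.
Qed.

Lemma exp_bounded_integrable (f : R -> R) : {within `[0, +oo[, continuous f} ->
  (forall t : R, 0 <= t -> `|f t| <= C * expR (- (b * t))) ->
  leb.-integrable `[0%R, +oo[ (EFin \o f).
Proof.
move=> cf fe; apply: le_integrable integrable_e => //.
  by apply/measurable_EFinP; exact: measurable_within.
move=> t /=; rewrite in_itv /= andbT => t0.
by rewrite lee_fin (ger0_norm (e0 t)); exact: fe.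
Qed.

(** The fundamental theorem on a half-line for an integrand of either sign:
    add the dominating exponential to reach the nonnegative case, then
    subtract its integral. *)
Lemma exp_bounded_FTC (f F : R -> R) (l : R) : {within `[0, +oo[, continuous f} ->
  (forall t : R, 0 <= t -> `|f t| <= C * expR (- (b * t))) ->
  (forall t : R, 0 < t -> is_derive t 1 F (f t)) ->
  F x @[x --> 0^'+] --> F 0 -> F x @[x --> +oo] --> l ->
  \int[leb]_(t in `[0, +oo[) f t = l - F 0.
Proof.
move=> cf fe dF F0 Fl.
have ce : {within `[0, +oo[, continuous e} by exact/cont_within/continuous_exp.
have ife := exp_bounded_integrable cf fe.
have dFE (t : R) : 0 < t -> is_derive t 1 (fun t : R => F t + Ep t) (f t + e t).
  by move=> /dF h; exact: is_deriveD h (dEp t).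
have : \int[leb]_(t in `[0, +oo[) (f t + e t) = l + 0 - (F 0 + Ep 0).
  apply: (@Rintegral_ge0_continuous_FTC2y _ _ (fun t : R => F t + Ep t)).
  - move=> t t0; have := fe t t0; rewrite ler_norml => /andP[+ _].
    by rewrite -subr_ge0 opprK.
  - move=> t; apply: continuousD; [exact: cf|exact: ce].
  - by apply: cvgD => //; exact: exp_decay_cvg0.
  - by move=> t t0; have [] := dFE t t0.
  - by apply: cvgD => //; exact/within_cvg0/cont_within/continuous_exp.
  - move=> t; rewrite in_itv /= andbT => t0.
    by rewrite derive1E; have [] := dFE t t0.
rewrite RintegralD//.
have -> : \int[leb]_(t in `[0, +oo[) e t = 0 - Ep 0.
  by rewrite /Rintegral int_e -EFinB.
by move: (Rintegral _ _ _) (Ep 0) => I E0; lra.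
Qed.

End ExponentiallyBoundedIntegrals.

Section DeviationMatrix.
Context {R : realType} {d : nat} {Q : 'M[R]_d}.
Variable J : markov_process (fun i j : 'I_d => Q i j).
Hypothesis J_irreducible : irreducible_process J.
Variable varpi : 'cV[R]_d.
Hypothesis varpi_stationary : stationary_distribution J (fun i => varpi i 0).
Notation leb := (@lebesgue_measure R).

Let p (t : R) (i j : 'I_d) := transition_prob J t i j.
Let D := deviation_matrix J varpi.

Let increment h t i j : 0 <= h -> 0 <= t ->
  p (h + t) i j - p t i j = \sum_k (p h i k - (i == k)%:R) * p t k j.
Proof.
move=> h0 t0; rewrite /p chapman_kolmogorov//.
under [RHS]eq_bigr do rewrite mulrBl; rewrite sumrB; congr (_ - _).
rewrite (bigD1 i)//= eqxx mul1r big1 ?addr0// => k.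
by rewrite eq_sym => /negbTE ->; rewrite mul0r.
Qed.


(** [p t - p (t - h)] is [p h - 1] applied to a bounded vector. *)
Lemma transition_prob_left_cvg t i j : 0 < t ->
  p (t - h) i j @[h --> 0^'+] --> p t i j.
Proof.
move=> t0.
have cv : \sum_k `|p h i k - (i == k)%:R| @[h --> 0^'+] --> (0 : R).
  have E : \sum_(k < d) `|(i == k)%:R - (i == k)%:R| = 0 :> R.
    by rewrite big1// => k _; rewrite subrr normr0.
  rewrite -[X in _ --> X]E.
  apply: cvg_sumr => k _; apply: cvg_norm; apply: cvgB; last exact: cvg_cst.
  exact: transition_prob_cvg_delta.
apply/subr_cvg0/norm_cvg0P.
apply: (squeeze_cvgr _ (cvg_cst 0) cv).
near=> h; have h0 : 0 <= h by rewrite ltW//; near: h; exact: nbhs_right_gt.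
have th : 0 <= t - h by rewrite subr_ge0 ltW//; near: h; exact: nbhs_right_lt.
rewrite normr_ge0 /= distrC.
have := increment i j h0 th; rewrite [h + _]addrC subrK => ->.
apply: le_trans (ler_norm_sum _ _ _) _; apply: ler_sum => k _.
rewrite normrM ler_piMr// ger0_norm ?transition_prob_ge0//.
exact: transition_prob_le1.
Unshelve. all: by end_near. Qed.

(** The rates only prescribe a derivative at 0 from the right; the left
    difference quotient at [t] reduces to it through the semigroup property
    and left continuity. *)
Lemma kolmogorov_backward (t : R) i j : 0 < t ->
  is_derive t 1 (fun s : R => p s i j) (\sum_k Q i k * p t k j).
Proof.
move=> t0.
have cv : h^-1 * (p (h + t) i j - p t i j) @[h --> (0 : R)^'] -->
    (\sum_k Q i k * p t k j : R).
  apply: (@cvg_at_right_left_dnbhs _ R^o).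
    have : \sum_k (p h i k - (i == k)%:R) / h * p t k j @[h --> (0 : R)^'+] -->
        \sum_k Q i k * p t k j.
      by apply: cvg_sumr => k _; apply: cvgMr_tmp; exact: mp_rates.
    apply: cvg_trans; apply: near_eq_cvg; near=> h.
    have h0 : 0 <= h by rewrite ltW//; near: h; exact: nbhs_right_gt.
    rewrite increment// ?ltW// mulr_sumr; apply: eq_bigr => k _; ring.
  apply/cvg_at_leftNP; rewrite oppr0.
  have : \sum_k (p h i k - (i == k)%:R) / h * p (t - h) k j @[h --> (0 : R)^'+] -->
      \sum_k Q i k * p t k j.
    apply: cvg_sumr => k _; apply: cvgM; first exact: mp_rates.
    exact: transition_prob_left_cvg.
  apply: cvg_trans; apply: near_eq_cvg; near=> h.
  have h0 : 0 <= h by rewrite ltW//; near: h; exact: nbhs_right_gt.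
  have th : 0 <= t - h by rewrite subr_ge0 ltW//; near: h; exact: nbhs_right_lt.
  have := increment i j h0 th; rewrite [h + _]addrC subrK => E.
  rewrite /= [- h + t]addrC invrN mulNr -mulrN opprB E mulr_sumr.
  by apply: eq_bigr => k _; ring.
have dv : derivable (fun s => p s i j) t 1.
  apply/cvg_ex; exists (\sum_k Q i k * p t k j).
  by under eq_cvg do rewrite /GRing.scale /= mulr1.
apply: DeriveDef => //; apply: cvg_lim => //.
by under eq_cvg do rewrite /GRing.scale /= mulr1.
Unshelve. all: by end_near. Qed.

Lemma transition_prob_right_cvg0 i j : p h i j @[h --> 0^'+] --> p 0 i j.
Proof. rewrite /p transition_prob0; exact: transition_prob_cvg_delta. Qed.

Lemma transition_prob_continuous i j :
  {within `[0, +oo[, continuous (fun t => p t i j)}.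
Proof.
apply/continuous_within_itvcyP; split; last exact: transition_prob_right_cvg0.
move=> t; rewrite in_itv /= andbT => t0.
exact/is_derive_continuous/kolmogorov_backward.
Qed.

Let f i j t := p t i j - varpi j 0.

Let f_cont i j : {within `[0, +oo[, continuous (f i j)}.
Proof.
by move=> t; apply: cvgB; [exact: transition_prob_continuous|exact: cvg_cst].
Qed.

Let f_integrable i j : leb.-integrable `[0%R, +oo[ (EFin \o f i j).
Proof.
have [b [C [b0 C0 bd]]] := exponential_ergodicity J_irreducible varpi_stationary.
by apply: (exp_bounded_integrable b0 C0) => // t; exact: bd.
Qed.

Let Rintegral_sum (c : 'I_d -> R) (F : 'I_d -> R -> R) :
  (forall k, leb.-integrable `[0%R, +oo[ (EFin \o F k)) ->
  \int[leb]_(t in `[0, +oo[) (\sum_k c k * F k t) =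
  \sum_k c k * \int[leb]_(t in `[0, +oo[) F k t.
Proof.
move=> iF.
have icF k : leb.-integrable `[0%R, +oo[ (EFin \o (fun t => c k * F k t)).
  by apply: eq_integrable (integrableZl _ (c k) (iF k)) => // t _ /=; rewrite EFinM.
elim: (index_enum _) => [|k s IH].
  rewrite big_nil; under eq_Rintegral do rewrite big_nil.
  by rewrite Rintegral_cst//= ?mul0r.
rewrite big_cons -IH; under eq_Rintegral do rewrite big_cons.
rewrite RintegralD// ?RintegralZl//.
have isum := @integrable_sum _ _ R leb _ (measurable_itv _) _ s predT _
  (fun k _ => icF k).
by apply: eq_integrable isum => // t _; rewrite /= sumEFin.
Qed.

Lemma deviation_matrixE i j : D i j = \int[leb]_(t in `[0, +oo[) f i j t.
Proof. by rewrite mxE. Qed.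

Lemma varpi_deviation j : \sum_i varpi i 0 * D i j = 0.
Proof.
under eq_bigr do rewrite deviation_matrixE.
rewrite -Rintegral_sum//.
rewrite (@eq_Rintegral _ _ _ _ _ (fun=> 0)); first by rewrite Rintegral_cst//= ?mul0r.
move=> t; rewrite inE /= in_itv /= andbT => t0.
under eq_bigr do rewrite mulrBr.
rewrite sumrB (varpi_invariant varpi_stationary)//.
rewrite -mulr_suml (sum_varpi varpi_stationary).
by rewrite mul1r subrr.
Qed.

(** [Q] applied to the integrand is [Q * p t], the derivative of [p t], so the
    integral is the difference of the limits of [p] at infinity and at 0. *)
Lemma rates_deviation i j : \sum_k Q i k * D k j = varpi j 0 - (i == j)%:R.
Proof.
have [b [C [b0 C0 bd]]] := exponential_ergodicity J_irreducible varpi_stationary.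
under eq_bigr do rewrite deviation_matrixE.
rewrite -Rintegral_sum// -(transition_prob0 J).
have C0' : 0 <= (\sum_k `|Q i k|) * C by rewrite mulr_ge0// sumr_ge0.
apply: (@exp_bounded_FTC _ b _ b0 C0' _ (fun t => p t i j)).
- move=> t; apply: cvg_sumr => k _; apply: cvgM; [exact: cvg_cst|exact: f_cont].
- move=> t t0; apply: le_trans (ler_norm_sum _ _ _) _.
  rewrite -mulrA mulr_suml; apply: ler_sum => k _.
  by rewrite normrM ler_wpM2l// bd.
- move=> t t0; rewrite (_ : \sum_k _ = \sum_k Q i k * p t k j).
    exact: kolmogorov_backward.
  under eq_bigr do rewrite mulrBr.
  by rewrite sumrB -mulr_suml (rates_row_sum J) mul0r subr0.
- exact: transition_prob_right_cvg0.
- apply/subr_cvg0/norm_cvg0P.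
  have cv : C * expR (- (b * t)) @[t --> +oo] --> (0 : R).
    exact: exp_decay_cvg0.
  apply: (squeeze_cvgr _ (cvg_cst 0) cv).
  near=> t; rewrite normr_ge0 /=; apply: bd.
  near: t; exact: nbhs_pinfty_ge.
Unshelve. all: by end_near. Qed.

(** Solution of [Q u = varpi b - b], which is centred under [varpi]. *)
Lemma poisson_equation (b : 'I_d -> R) i :
  \sum_j Q i j * (\sum_k D j k * b k) = \sum_k varpi k 0 * b k - b i.
Proof.
under eq_bigr do rewrite mulr_sumr.
rewrite exchange_big /=.
under eq_bigr => k _.
  under eq_bigr do rewrite mulrA.
  rewrite -mulr_suml rates_deviation mulrBl.
  over.
rewrite sumrB; congr (_ - _); rewrite (bigD1 i)//= eqxx mul1r big1 ?addr0// => k.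
by rewrite eq_sym => /negbTE ->; rewrite mul0r.
Qed.

Lemma poisson_equation_centred (b : 'I_d -> R) :
  \sum_i varpi i 0 * (\sum_k D i k * b k) = 0.
Proof.
under eq_bigr do rewrite mulr_sumr.
rewrite exchange_big big1// => k _.
under eq_bigr do rewrite mulrA.
by rewrite -mulr_suml varpi_deviation mul0r.
Qed.

End DeviationMatrix.

(** * Stein's equation for compactly supported data *)

Section TaylorRemainders.
Context {R : realType}.

Lemma test_function_of_derivatives (K C : R) (h h1 h2 : R -> R) :
  (forall y : R, is_derive y 1 h (h1 y)) -> (forall y : R, is_derive y 1 h1 (h2 y)) ->
  (forall x t, `|h2 (x + t) - h2 x| <= K * `|t|) ->
  (forall x, [/\ `|h x| <= C * (1 + `|x|) ^+ 2,
                    `|h1 x| <= C * (1 + `|x|) ^+ 2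
                  & `|h2 x| <= C * (1 + `|x|) ^+ 2]) ->
  test_function K C h h1 h2.
Proof.
move=> dh dh1 lip gr.
have K0 : 0 <= K.
  by have := lip 0 1; rewrite normr1 mulr1; apply: le_trans.
have H1 x t : `|h1 (x + t) - h1 x - t * h2 x| <= K * `|t| ^+ 2.
  have [s st ->] := MVT_shift x t dh1.
  rewrite (_ : _ - _ = (h2 (x + s) - h2 x) * t); last by ring.
  rewrite normrM expr2 mulrA ler_wpM2r//.
  by apply: le_trans (lip _ _) _; rewrite ler_wpM2l.
split => // x t.
pose F (s : R) := h (x + s) - s * h1 x - s ^+ 2 / 2 * h2 x.
pose G (s : R) := h1 (x + s) - h1 x - s * h2 x.
have dF (s : R) : is_derive s 1 F (G s).
  have dhx : is_derive s 1 (fun s : R => h (x + s)) (h1 (x + s)).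
    have := is_deriveD (is_derive_cst x s 1) (is_derive_id s 1).
    rewrite add0r => dxs.
    by rewrite -[h1 _]mulr1; exact: (@is_derive1_comp _ h (cst x + id) s).
  by rewrite /F /G; apply: is_derive_eq; rewrite /GRing.scale /=; field.
have [s st] := MVT_shift 0 t dF.
rewrite !add0r => E.
rewrite (_ : _ - _ = F t - F 0); last by rewrite /F addr0; ring.
rewrite E normrM exprSr mulrA ler_wpM2r//.
apply: le_trans (H1 _ _) _; rewrite ler_wpM2l// lerXn2r ?nnegrE//.
Qed.

End TaylorRemainders.

Section SteinEquation.
Context {R : realType}.
Notation leb := (@lebesgue_measure R).
Variable v : R.
Hypothesis v0 : 0 < v.

Definition gauss_density : R -> R := normal_pdf 0 (Num.sqrt v).
Let w := gauss_density.

Let s0 : Num.sqrt v != 0. Proof. by rewrite gt_eqF// sqrtr_gt0. Qed.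

Let wE x : w x = normal_peak (Num.sqrt v) * expR (- x ^+ 2 / (v *+ 2)).
Proof.
by rewrite /w /gauss_density normal_pdfE// /normal_fun subr0 sqr_sqrtr// ltW.
Qed.

Let w_gt0 x : 0 < w x.
Proof. by rewrite wE mulr_gt0 ?expR_gt0// normal_peak_gt0. Qed.

Let w_derive (x : R) : is_derive x 1 w (- x / v * w x).
Proof.
have -> : w = fun x => normal_peak (Num.sqrt v) * expR (- x ^+ 2 / (v *+ 2)).
  by apply/funext => y; exact: wE.
apply: is_derive_eq; rewrite /GRing.scale /=; field.
by rewrite gt_eqF.
Qed.

Let w_mono A x : `|x| <= A -> w A <= w x.
Proof.
move=> xA; rewrite !wE ler_wpM2l ?normal_peak_ge0// ler_expR.
rewrite ler_pM2r ?invr_gt0 ?pmulrn_lgt0// lerN2 -(real_normK (num_real x)).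
by rewrite lerXn2r ?nnegrE// (le_trans _ xA).
Qed.

Let w_integrable : leb.-integrable [set: R] (EFin \o w).
Proof. exact: integrable_normal_pdf. Qed.

Lemma dominated_by_gauss_integrable (m : R -> R) c : continuous m ->
  (forall x, `|m x| <= c * w x) -> leb.-integrable [set: R] (EFin \o m).
Proof.
move=> cm mw; have iw := integrableZl measurableT c w_integrable.
apply: le_integrable iw => //.
  by apply/measurable_EFinP; exact: continuous_measurable_fun.
move=> x _; rewrite -[X in (_ <= X)%E]/(`|c * w x|%:E) lee_fin.
by apply: le_trans (mw x) _; exact: ler_norm.
Qed.

Definition primitive (m : R -> R) x := \int[leb]_(t in `]-oo, x]) m t.

Lemma is_derive_primitive m : continuous m ->
  leb.-integrable [set: R] (EFin \o m) ->
  forall x : R, is_derive x 1 (primitive m) (m x).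
Proof.
move=> cm im x.
have xu : x < x + 1 by rewrite ltrDl.
have iu : leb.-integrable `]-oo, (x + 1)] (EFin \o m) by exact: integrableS im.
have [dF E] := @continuous_FTC1 R m -oo%O x (x + 1) xu iu (ltNyr _) (cm x).
by apply: DeriveDef => //; rewrite -derive1E.
Qed.

Variables (f : R -> R) (A Lf : R).
Hypothesis A0 : 0 <= A.
Hypothesis f_lip : forall x y, `|f x - f y| <= Lf * `|x - y|.
Hypothesis f_supp : forall x, A <= `|x| -> f x = 0.
Hypothesis f_mean : \int[leb]_x (f x * w x) = 0.

Let Lf0 : 0 <= Lf.
Proof. by have := f_lip 1 0; rewrite subr0 normr1 mulr1; apply: le_trans. Qed.

Let Bf := Lf * (A + A).

Let f_bound x : `|f x| <= Bf.
Proof.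
have [xA|Ax] := leP A `|x|.
  by rewrite f_supp// normr0 mulr_ge0// addr_ge0.
have fA : f A = 0 by rewrite f_supp// ger0_norm.
have := f_lip x A; rewrite fA subr0 => /le_trans; apply.
rewrite ler_wpM2l//; apply: le_trans (ler_normB _ _) _.
by rewrite (ger0_norm A0) lerD2r ltW.
Qed.

Let f_cont : continuous f. Proof. exact: lipschitz_continuous f_lip. Qed.

Let m x := f x * w x.
Let m_cont : continuous m.
Proof.
move=> x; apply: cvgM; first exact: f_cont.
exact: is_derive_continuous (w_derive x).
Qed.

Let m_int : leb.-integrable [set: R] (EFin \o m).
Proof.
apply: (@dominated_by_gauss_integrable _ Bf) => // x.
by rewrite normrM (gtr0_norm (w_gt0 x)) ler_wpM2r// ltW.
Qed.

Let Phi := primitive m.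

(** To the right of the support, [Phi] is the whole integral of [m], which
    vanishes because [f] is centred. *)
Let Phi_supp x : A <= `|x| -> Phi x = 0.
Proof.
move=> Ax; have [x0|x0] := leP 0 x.
  have : \int[leb]_t m t = Phi x + \int[leb]_(t in `]x, +oo[) m t.
    rewrite /Phi /primitive -Rintegral_setU//.
    - by rewrite itv_setU_setT.
    - by rewrite itv_setU_setT.
    - apply/disj_setPS => t [] /=; rewrite !in_itv /= andbT => tx xt.
      by move: (le_lt_trans tx xt); rewrite ltxx.
  rewrite f_mean (@eq_Rintegral _ _ _ leb `]x, +oo[ (fun=> 0)).
    by rewrite Rintegral_cst//= mul0r addr0 => <-.
  move=> t; rewrite inE /= in_itv /= andbT => xt; rewrite /m f_supp ?mul0r//.
  by rewrite (le_trans Ax)// !ger0_norm// ltW// (le_lt_trans x0).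
rewrite /Phi /primitive (@eq_Rintegral _ _ _ leb `]-oo, x] (fun=> 0)).
  by rewrite Rintegral_cst//= mul0r.
move=> t; rewrite inE /= in_itv /= => tx; rewrite /m f_supp ?mul0r//.
by rewrite (le_trans Ax)// !ler0_norm ?lerN2// ltW// (le_lt_trans tx).
Qed.

(** The classical solution of [v * h1' - x * h1 = f] by variation of
    constants. *)
Let h1 x := Phi x / (v * w x).
Let h2 x := (f x + x * h1 x) / v.

Let h1_derive (x : R) : is_derive x 1 h1 (h2 x).
Proof.
have dPhi : is_derive x 1 Phi (m x) by exact: is_derive_primitive.
have vw : v * w x != 0 by rewrite mulf_neq0// gt_eqF.
have dw := w_derive x.
rewrite /h1; apply: is_derive_eq; rewrite /GRing.scale /=.
rewrite /h2 /h1 /m; field.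
by rewrite !gt_eqF.
Qed.

Let h1_supp x : A <= `|x| -> h1 x = 0.
Proof. by move=> Ax; rewrite /h1 Phi_supp// mul0r. Qed.

Let h2_supp x : A <= `|x| -> h2 x = 0.
Proof. by move=> Ax; rewrite /h2 h1_supp// f_supp// mulr0 addr0 mul0r. Qed.

Let h1_cont : continuous h1.
Proof. by move=> x; exact: is_derive_continuous (h1_derive x). Qed.

Let h1_bound : exists2 B1, 0 <= B1 & forall x, `|h1 x| <= B1.
Proof.
have AA : - A <= A by rewrite (@le_trans _ _ 0)// oppr_le0.
have cn : {within `[- A, A], continuous (fun x => `|h1 x|)}.
  by apply: continuous_subspaceT => x; apply: cvg_norm; exact: h1_cont.
have [c _ Hc] := EVT_max AA cn.
exists `|h1 c| => // x; have [/h1_supp ->|xA] := leP A `|x|.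
  by rewrite normr0.
by apply: Hc; rewrite in_itv /= -ler_norml ltW.
Qed.

(** For centred [f] with compact support the solution [g1] has compact support
    too, so that it is bounded together with its derivative [g2] by mere
    continuity; [g2] is Lipschitz since the equation expresses it through [f]
    and [x * g1]. *)
Lemma stein_solution : exists h g1 g2 : R -> R, exists K C B : R,
  [/\ test_function K C h g1 g2, forall x, `|g2 x| <= B
    & forall x, v * g2 x - x * g1 x = f x].
Proof.
have [B1 B10 hB1] := h1_bound.
have Bf0 : 0 <= Bf by exact: le_trans (normr_ge0 _) (f_bound 0).
pose B2 := (Bf + A * B1) / v.
have B20 : 0 <= B2.
  exact: divr_ge0 (addr_ge0 Bf0 (mulr_ge0 A0 B10)) (ltW v0).
have hB2 x : `|h2 x| <= B2.
  have [/h2_supp ->|xA] := leP A `|x|; first by rewrite normr0.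
  rewrite /h2 normrM [`|v^-1|]gtr0_norm ?invr_gt0// ler_pM2r ?invr_gt0//.
  apply: le_trans (ler_normD _ _) _; rewrite lerD// normrM ler_pM//; exact: ltW.
pose B3 := B1 + A * B2.
have xh1_derive (x : R) : is_derive x 1 (fun x => x * h1 x) (h1 x + x * h2 x).
  have := h1_derive x => d1; apply: is_derive_eq.
  by rewrite /GRing.scale /=; ring.
have hB3 x : `|h1 x + x * h2 x| <= B3.
  apply: le_trans (ler_normD _ _) _; rewrite lerD//.
  have [/h2_supp ->|xA] := leP A `|x|; first by rewrite mulr0 normr0 mulr_ge0.
  by rewrite normrM ler_pM// ltW.
pose K := (Lf + B3) / v.
have h2_lip x t : `|h2 (x + t) - h2 x| <= K * `|t|.
  rewrite /h2 -mulrBl normrM [`|v^-1|]gtr0_norm ?invr_gt0// /K mulrAC.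
  rewrite ler_pM2r ?invr_gt0// opprD addrACA (mulrDl Lf).
  apply: le_trans (ler_normD _ _) _; apply: lerD.
    by apply: le_trans (f_lip _ _) _; rewrite [x + t]addrC addrK.
  have [s _ ->] := MVT_shift x t xh1_derive.
  by rewrite normrM ler_wpM2r.
have h1_int : leb.-integrable [set: R] (EFin \o h1).
  apply: (@dominated_by_gauss_integrable _ (B1 / w A)) => // x.
  have [/h1_supp ->|xA] := leP A `|x|.
    by rewrite normr0 mulr_ge0 ?divr_ge0// ltW.
  apply: le_trans (hB1 x) _; rewrite mulrAC ler_pdivlMr//.
  by rewrite ler_wpM2l// w_mono// ltW.
pose h := primitive h1.
have dh : forall x : R, is_derive x 1 h (h1 x) by exact: is_derive_primitive.
pose C := `|h 0| + B1 + B2.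
exists h, h1, h2, K, C, B2; split => //; last first.
  by move=> x; rewrite /h2; field; rewrite gt_eqF.
apply: test_function_of_derivatives => // x.
have sq : 1 + `|x| <= (1 + `|x|) ^+ 2.
  by have := normr_ge0 x; move: `|x| => y y0; nra.
have C0 : 0 <= C by rewrite !addr_ge0.
have x0 := normr_ge0 x.
have le1 c : c <= C -> c <= C * (1 + `|x|) ^+ 2.
  move=> cC; apply: le_trans cC _; rewrite ler_peMr//.
  by apply: le_trans sq; rewrite lerDl.
split; last 2 first.
- apply: le1; apply: le_trans (hB1 x) _.
  by rewrite /C; have := normr_ge0 (h 0); lra.
- apply: le1; apply: le_trans (hB2 x) _.
  by rewrite /C; have := normr_ge0 (h 0); lra.
have [s _] := MVT_shift 0 x dh; rewrite add0r => E.
have : `|h x| <= `|h 0| + B1 * `|x|.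
  rewrite -[h x](subrK (h 0)) E addrC; apply: le_trans (ler_normD _ _) _.
  by rewrite lerD2l normrM ler_wpM2r.
move/le_trans; apply; apply: (@le_trans _ _ (C * (1 + `|x|))).
  rewrite /C; have := normr_ge0 (h 0).
  by move: (`|h 0|) => z z0; nra.
by rewrite ler_wpM2l.
Qed.

End SteinEquation.

(** * Convergence in distribution from Lipschitz test functions *)

Section LipschitzEnvelope.
Context {R : realType}.
Variables (f : R -> R) (B : R).
Hypothesis f_cont : continuous f.
Hypothesis f_bound : forall x, `|f x| <= B.

(** Inf-convolution of [f] with the cone of slope [L]. *)
Definition lipschitz_envelope (L x : R) : R :=
  inf [set f y + L * `|x - y| | y in [set: R]].

Let B0 : 0 <= B. Proof. exact: le_trans (normr_ge0 _) (f_bound 0). Qed.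

Let lb L x : 0 <= L -> lbound [set f y + L * `|x - y| | y in [set: R]] (- B).
Proof.
move=> L0 _ [y _ <-]; have := f_bound y; rewrite ler_norml => /andP[+ _].
by move=> /le_trans; apply; rewrite lerDl mulr_ge0.
Qed.

Lemma lipschitz_envelope_le L x y : 0 <= L ->
  lipschitz_envelope L x <= f y + L * `|x - y|.
Proof. by move=> L0; apply: ge_inf; [exists (- B); exact: lb|exists y]. Qed.

Lemma lipschitz_envelope_ge L x z : (forall y, z <= f y + L * `|x - y|) ->
  z <= lipschitz_envelope L x.
Proof.
by move=> H; apply: lb_le_inf => [|_ [y _ <-]//]; exists (f x + L * `|x - x|), x.
Qed.

Lemma lipschitz_envelope_le_fun L x : 0 <= L -> lipschitz_envelope L x <= f x.
Proof.
by move=> L0; have := @lipschitz_envelope_le L x x L0; rewrite subrr normr0 mulr0 addr0.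
Qed.

Lemma lipschitz_envelope_bound L x : 0 <= L -> `|lipschitz_envelope L x| <= B.
Proof.
move=> L0; rewrite ler_norml; apply/andP; split.
  by apply: lipschitz_envelope_ge => y; apply: (lb L0); exists y.
apply: le_trans (lipschitz_envelope_le_fun x L0) _.
exact: le_trans (ler_norm _) (f_bound x).
Qed.

Lemma lipschitz_envelope_lip L x x' : 0 <= L ->
  `|lipschitz_envelope L x - lipschitz_envelope L x'| <= L * `|x - x'|.
Proof.
move=> L0.
have half a a' : lipschitz_envelope L a - lipschitz_envelope L a' <= L * `|a - a'|.
  rewrite lerBlDl -lerBlDr; apply: lipschitz_envelope_ge => y.
  rewrite lerBlDr -addrA -mulrDr; apply: le_trans (lipschitz_envelope_le a y L0) _.
  by rewrite lerD2l ler_wpM2l// [X in _ <= X]addrC ler_distD.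
by rewrite ler_norml half andbT lerNl opprB distrC half.
Qed.

(** Points [y] near [x] have values close to [f x] by continuity, and at the
    others the cone exceeds the oscillation [B + B] of [f]. *)
Lemma lipschitz_envelope_cvg x :
  (fun n : nat => lipschitz_envelope n%:R x) @ \oo --> f x.
Proof.
apply/cvgrPdist_le => e e0.
have /cvgrPdist_le /(_ e e0) [r /= r0 Hr] : f x' @[x' --> x] --> f x by exact: f_cont.
near=> n.
have n0 : 0 <= n%:R :> R by [].
rewrite ger0_norm ?subr_ge0; last exact: lipschitz_envelope_le_fun.
rewrite lerBlDr -lerBlDl; apply: lipschitz_envelope_ge => y.
have [yr|ry] := ltP `|x - y| r.
  have := Hr y yr; rewrite ler_norml => /andP[_ +].
  move=> fxy; have : 0 <= n%:R * `|x - y| by rewrite mulr_ge0.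
  by move: fxy; lra.
have nr : (B + B) / r <= n%:R by near: n; exact: nbhs_infty_ger.
have : B + B <= n%:R * `|x - y|.
  rewrite ler_pdivrMr// in nr; apply: le_trans nr _; exact: ler_wpM2l.
have := f_bound x; have := f_bound y; rewrite !ler_norml.
by move=> /andP[? _] /andP[_ ?]; lra.
Unshelve. all: by end_near. Qed.

End LipschitzEnvelope.

Section BoundedExpectations.
Context {R : realType} {dT : measure_display} {T : measurableType dT}.
Variables (P : probability T R) (X : T -> R).
Hypothesis mX : measurable_fun setT X.

Definition expect (f : R -> R) : R := \int[P]_w f (X w).

Lemma expect_measurable (f : R -> R) : continuous f ->
  measurable_fun setT (fun w => f (X w)).
Proof. by move=> cf; apply: measurableT_comp => //; exact: continuous_measurable_fun. Qed.

Lemma expect_integrable (f : R -> R) B : continuous f -> (forall x, `|f x| <= B) ->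
  P.-integrable setT (EFin \o (fun w => f (X w))).
Proof.
move=> cf fB; apply: measurable_bounded_integrable => //.
- by apply: le_lt_trans (probability_le1 P measurableT) _; rewrite ltry.
- exact: expect_measurable.
- exists B; split; first exact: num_real.
  by move=> b Bb w _; apply: le_trans (fB _) (ltW Bb).
Qed.

Lemma expect_EFin (f : R -> R) B : continuous f -> (forall x, `|f x| <= B) ->
  (\int[P]_w (f (X w))%:E = (expect f)%:E)%E.
Proof.
move=> cf fB; rewrite /expect /Rintegral fineK//.
exact: integrable_fin_num (expect_integrable cf fB).
Qed.

Lemma expect_cst c : expect (fun=> c) = c.
Proof.
rewrite /expect Rintegral_cst//; have -> : fine (P setT) = 1 by rewrite probability_setT.
by rewrite mulr1.
Qed.

Lemma expectD (f g : R -> R) Bf Bg : continuous f -> (forall x, `|f x| <= Bf) ->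
  continuous g -> (forall x, `|g x| <= Bg) ->
  expect (fun x => f x + g x) = expect f + expect g.
Proof.
move=> cf fB cg gB; rewrite /expect RintegralD//.
  exact: expect_integrable cf fB.
exact: expect_integrable cg gB.
Qed.

Lemma expectZ (f : R -> R) c Bf : continuous f -> (forall x, `|f x| <= Bf) ->
  expect (fun x => c * f x) = c * expect f.
Proof.
by move=> cf fB; rewrite /expect RintegralZl//; exact: expect_integrable cf fB.
Qed.

Lemma le_expect (f g : R -> R) Bf Bg : continuous f -> (forall x, `|f x| <= Bf) ->
  continuous g -> (forall x, `|g x| <= Bg) -> (forall x, f x <= g x) ->
  expect f <= expect g.
Proof.
move=> cf fB cg gB fg; apply: le_Rintegral => //.
  exact: expect_integrable cf fB.
exact: expect_integrable cg gB.
Qed.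

Lemma expect_norm_le (f g : R -> R) Bg : continuous f ->
  continuous g -> (forall x, `|g x| <= Bg) -> (forall x, `|f x| <= g x) ->
  `|expect f| <= expect g.
Proof.
move=> cf cg gB fg.
have fB x : `|f x| <= Bg.
  by apply: le_trans (fg x) _; exact: le_trans (ler_norm _) (gB x).
have cNg : continuous (fun x => -1 * g x).
  by move=> x; apply: cvgMl_tmp; exact: cg.
have NgB x : `|-1 * g x| <= Bg by rewrite mulN1r normrN.
rewrite ler_norml -mulN1r -(expectZ _ cg gB).
apply/andP; split.
- apply: (le_expect cNg NgB cf fB) => x.
  by have := fg x; rewrite mulN1r ler_norml => /andP[].
- apply: (le_expect cf fB cg gB) => x.
  exact: le_trans (ler_norm _) (fg x).
Qed.

Lemma expect_cvg (f_ : nat -> R -> R) (f : R -> R) B : (forall n, continuous (f_ n)) ->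
  continuous f -> (forall n x, `|f_ n x| <= B) ->
  (forall x, f_ ^~ x @ \oo --> f x) -> (fun n => expect (f_ n)) @ \oo --> expect f.
Proof.
move=> cf_ cf f_B f_f.
have fB x : `|f x| <= B.
  have h : (fun n => `|f_ n x|) @ \oo --> `|f x| by apply: cvg_norm; exact: f_f.
  rewrite -(cvg_lim (@Rhausdorff R) h).
  apply: limr_le; first by apply/cvg_ex; exists `|f x|.
  by apply: nearW => n; exact: f_B.
have [] := @dominated_convergence _ T R P setT measurableT
  (fun n w => (f_ n (X w))%:E) (fun w => (f (X w))%:E) (fun=> B%:E).
- by move=> n; apply/measurable_EFinP; exact: expect_measurable.
- by apply/measurable_EFinP; exact: expect_measurable.
- by apply: aeW => w _; apply: cvg_EFin; [exact: nearW|exact: f_f].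
- exact: finite_measure_integrable_cst.
- by apply: aeW => w n _; rewrite lee_fin.
move=> _ _; rewrite (expect_EFin cf fB) => /fine_cvg.
apply: cvg_trans; apply: near_eq_cvg; apply: nearW => n /=.
by rewrite (expect_EFin (cf_ n) (f_B n)).
Qed.

End BoundedExpectations.

(** [measurableTypeR R] and [R] carry the same measurable sets under different
    displays, so that integrals over them are related by the push-forward along
    the identity rather than by conversion. *)
Lemma integral_measurableTypeR (R : realType) (nu : probability (measurableTypeR R) R)
    (f : R -> R) : continuous f ->
  nu.-integrable setT (EFin \o (f : measurableTypeR R -> R)) ->
  (@integral _ (R : measurableType _) R nu setT (fun x => (f x)%:E) =
   \int[nu]_x (f x)%:E)%E.
Proof.
move=> cf intf.
pose phi : measurableTypeR R -> (R : measurableType _) := fun x => x.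
have mphi : measurable_fun setT phi by move=> _ Y mY; rewrite setTI.
have mf : measurable_fun [set: R] (EFin \o f).
  by apply/measurable_EFinP; exact: continuous_measurable_fun.
have := @integral_pushforward _ _ _ _ R phi mphi nu setT (EFin \o f) mf.
by move=> /(_ intf measurableT).
Qed.

(** The envelopes increase to [f] and are Lipschitz, hence bound the lower limit
    of the expectations of [f] from below; the upper limit follows from the same
    bound for [- f]. *)
Lemma cvg_in_distribution_of_lipschitz (R : realType) (dT : nat -> measure_display)
    (T : forall n, measurableType (dT n)) (P : forall n, probability (T n) R)
    (X : forall n, T n -> R) (nu : probability (measurableTypeR R) R) :
  (forall n, measurable_fun setT (X n)) ->
  (forall (f : R -> R) L B, (forall x y, `|f x - f y| <= L * `|x - y|) ->
     (forall x, `|f x| <= B) ->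
     (fun n => expect (P n) (X n) f) @ \oo --> expect nu id f) ->
  cvg_in_distribution P X nu.
Proof.
move=> mX H.
have mid : measurable_fun setT (id : measurableTypeR R -> R) by exact: measurable_id.
have low (f : R -> R) B e : continuous f -> (forall x, `|f x| <= B) -> 0 < e ->
    \forall n \near \oo, expect nu id f - e <= expect (P n) (X n) f.
  move=> cf fB e0.
  have e2 : 0 < e / 2 by rewrite divr_gt0.
  pose fL n := lipschitz_envelope f n%:R.
  have lipL n x y : `|fL n x - fL n y| <= n%:R * `|x - y|.
    by apply: (lipschitz_envelope_lip fB).
  have bL n x : `|fL n x| <= B by exact: lipschitz_envelope_bound.
  have cL n : continuous (fL n) by exact: lipschitz_continuous (lipL n).
  have := expect_cvg (P := nu) mid cL cf bL (lipschitz_envelope_cvg cf fB).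
  move=> /cvgrPdist_le /(_ _ e2) [m _ /(_ m (leqnn m))] /= Hm.
  have := H (fL m) m%:R B (lipL m) (bL m) => /cvgrPdist_le /(_ _ e2).
  apply: filterS => n Hn.
  have : expect (P n) (X n) (fL m) <= expect (P n) (X n) f.
    apply: (le_expect _ (mX n) (cL m) (bL m) cf fB) => x.
    exact: lipschitz_envelope_le_fun.
  by move: Hm Hn; rewrite !ler_norml => /andP[? ?] /andP[? ?]; lra.
move=> f cf [B fB].
suff : (fun n => (\int[P n]_w (f (X n w))%:E)%E) @ \oo --> (expect nu id f)%:E.
  rewrite -(expect_EFin nu mid cf fB) -(integral_measurableTypeR cf)//.
  exact: (expect_integrable nu mid cf fB).
have -> : (fun n => (\int[P n]_w (f (X n w))%:E)%E) =
    (fun n => (expect (P n) (X n) f)%:E).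
  by apply/funext => n; exact: (expect_EFin (P n) (mX n) cf fB).
apply: cvg_EFin; first exact: nearW.
apply/cvgrPdist_le => e e0.
have cNf : continuous (fun x => -1 * f x).
  by move=> x; apply: cvgMl_tmp; exact: cf.
have NfB x : `|-1 * f x| <= B by rewrite mulN1r normrN.
near=> n.
have : expect nu id f - e <= expect (P n) (X n) f.
  by near: n; exact: low cf fB e0.
have : expect nu id (fun x => -1 * f x) - e <= expect (P n) (X n) (fun x => -1 * f x).
  by near: n; exact: low cNf NfB e0.
rewrite (expectZ nu mid _ cf fB) (expectZ _ (mX n) _ cf fB) ler_norml.
by move=> *; apply/andP; split; rewrite /=; lra.
Unshelve. all: by end_near. Qed.

(** * Expectations of a count and under a normal law *)

Lemma measurable_nat_comp (R : realType) (dT : measure_display)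
    (T : measurableType dT) (P : probability T R) (M : {RV P >-> nat}) (F : nat -> R) :
  measurable_fun setT (fun w => F (M w)).
Proof. by apply: (@measurableT_comp _ _ _ _ _ _ F) => //; move=> _ Y _. Qed.

Lemma Rintegral_nat_series (R : realType) (dT : measure_display)
    (T : measurableType dT) (P : probability T R) (M : {RV P >-> nat})
    (q : nat -> R) (F : nat -> R) (B : R) :
  (forall k, P (M @^-1` [set k]) = (q k)%:E) -> (forall k, `|F k| <= B) ->
  (fun n => \sum_(k < n) q k * F k) @ \oo --> \int[P]_w F (M w).
Proof.
move=> qP FB.
have B0 : 0 <= B by exact: le_trans (normr_ge0 _) (FB 0%N).
pose F_ n k := if (k < n)%N then F k else 0.
have F_B n k : `|F_ n k| <= B by rewrite /F_; case: ifP => // _; rewrite normr0.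
have int G : (forall k, `|G k| <= B) -> P.-integrable setT (EFin \o (fun w => G (M w))).
  move=> GB; apply: measurable_bounded_integrable => //.
  - by apply: le_lt_trans (probability_le1 P measurableT) _; rewrite ltry.
  - exact: measurable_nat_comp.
  - exists B; split; first exact: num_real.
    by move=> b Bb w _; apply: le_trans (GB _) (ltW Bb).
have -> : (fun n => \sum_(k < n) q k * F k) = (fun n => \int[P]_w F_ n (M w)).
  apply/funext; elim=> [|n IH].
    rewrite big_ord0; under eq_Rintegral do rewrite /F_ ltn0.
    by rewrite Rintegral_cst// mul0r.
  rewrite big_ord_recr /= IH.
  have mMn : measurable (M @^-1` [set n]).
    by rewrite -[X in measurable X]setTI; exact: measurable_funP.
  have iI : P.-integrable setT (EFin \o (\1_(M @^-1` [set n]) : T -> R)).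
    exact: integrable_indic.
  have -> : q n * F n = F n * \int[P]_w \1_(M @^-1` [set n]) w.
    rewrite mulrC /Rintegral integral_indic// setIT; congr (_ * _).
    by rewrite -[RHS]/(fine (P (M @^-1` [set n]))) qP.
  rewrite -RintegralZl// -RintegralD//.
  - apply: eq_Rintegral => w _; rewrite /F_ indicE.
    have [Mn|Mn] := M w =P n.
      by rewrite (mem_set (Mn : (M @^-1` [set n]) w)) Mn ltnn ltnSn mulr1 add0r.
    rewrite memNset// mulr0 addr0; move/eqP in Mn.
    by rewrite [(M w < n.+1)%N]ltnS [(M w <= n)%N]leq_eqVlt (negbTE Mn).
  - exact: int.
  - by apply: eq_integrable (integrableZl _ (F n) iI).
have [] := @dominated_convergence _ T R P setT measurableT
  (fun n w => (F_ n (M w))%:E) (fun w => (F (M w))%:E) (fun=> B%:E).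
- by move=> n; apply/measurable_EFinP; exact: measurable_nat_comp.
- by apply/measurable_EFinP; exact: measurable_nat_comp.
- apply: aeW => w _; apply: cvg_near_cst; exists (M w).+1 => // n /= Mn.
  by rewrite /F_ Mn.
- exact: finite_measure_integrable_cst.
- by apply: aeW => w n _; rewrite lee_fin.
move=> _ _ cv.
have E G : (forall k, `|G k| <= B) ->
    (\int[P]_w (G (M w))%:E = (\int[P]_w G (M w))%:E)%E.
  by move=> GB; rewrite /Rintegral fineK//; exact: integrable_fin_num (int G GB).
rewrite (E F FB) in cv; move/fine_cvg: cv; apply: cvg_trans.
by apply: near_eq_cvg; apply: nearW => n /=; rewrite (E _ (F_B n)).
Qed.

Section NormalExpectation.
Context {R : realType}.
Notation leb := (@lebesgue_measure R).
Variable v : R.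

Definition gauss_prob : probability (measurableTypeR R) R := normal_prob 0 (Num.sqrt v).

(** The Radon-Nikodym derivative of the normal law is almost everywhere its
    density. *)
Lemma expect_normal (f : R -> R) B : continuous f -> (forall x, `|f x| <= B) ->
  expect gauss_prob id f = \int[leb]_x (f x * gauss_density v x).
Proof.
move=> cf fB.
have mid : measurable_fun setT (id : measurableTypeR R -> R) by exact: measurable_id.
have fi := expect_integrable gauss_prob mid cf fB.
rewrite /expect /Rintegral; congr fine.
rewrite -(Radon_Nikodym_change_of_variables (normal_prob_dominates 0 (Num.sqrt v)))//.
have mw : measurable_fun setT (EFin \o gauss_density v).
  by apply/measurable_EFinP; exact: measurable_normal_pdf.
have mf : measurable_fun [set: measurableTypeR R] (EFin \o f).
  by apply/measurable_EFinP; exact: continuous_measurable_fun.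
under [RHS]eq_integral do rewrite EFinM.
apply: ae_eq_integral => //.
- apply: emeasurable_funM => //; apply: (measurable_int leb).
  by apply: Radon_Nikodym_integrable; exact: normal_prob_dominates.
- exact: emeasurable_funM.
apply: ae_eqe_mul2l => /=.
rewrite Radon_NikodymE//=; first exact: normal_prob_dominates.
move=> dom; case: cid => /= h [h1 h2 h3].
apply: integral_ae_eq => //=.
by move=> E _ mE; rewrite -h3.
Qed.

End NormalExpectation.

(** * Gaussian limits from second moments and Stein's equation *)

Section Cutoff.
Context {R : realType}.

Definition cutoff (K x : R) : R := Num.min 1 (Num.max 0 (K + 1 - `|x|)).

Lemma cutoff_ge0 K x : 0 <= cutoff K x.
Proof. by rewrite /cutoff le_min ler01 le_max lexx. Qed.

Lemma cutoff_le1 K x : cutoff K x <= 1.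
Proof. by rewrite /cutoff ge_min lexx. Qed.

Lemma cutoff_eq1 K x : `|x| <= K -> cutoff K x = 1.
Proof.
by move=> xK; apply/min_idPl; rewrite le_max; apply/orP; right; lra.
Qed.

Lemma cutoff_eq0 K x : K + 1 <= `|x| -> cutoff K x = 0.
Proof.
move=> xK; rewrite /cutoff (max_idPl _) ?subr_le0//.
by apply/min_idPr; exact: ler01.
Qed.

Lemma cutoff_lip K x y : `|cutoff K x - cutoff K y| <= 1 * `|x - y|.
Proof.
rewrite mul1r; apply: (@le_trans _ _ `| `|x| - `|y| |); last exact: ler_dist_dist.
have abs (a b u w : R) : u - w <= `|a - b| -> w - u <= `|a - b| ->
    `|u - w| <= `|a - b|.
  by move=> h1 h2; rewrite ler_norml; apply/andP; split; lra.
have bd (a b : R) : a - b <= `|a - b| /\ b - a <= `|a - b|.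
  by split; [exact: ler_norm|rewrite distrC; exact: ler_norm].
have lip_max (a b : R) : `|Num.max 0 a - Num.max 0 b| <= `|a - b|.
  have [h1 h2] := bd a b; have h0 := normr_ge0 (a - b).
  by rewrite !maxElt; case: (ltP 0 a) => ?; case: (ltP 0 b) => ?; apply: abs; lra.
have lip_min (a b : R) : `|Num.min 1 a - Num.min 1 b| <= `|a - b|.
  have [h1 h2] := bd a b; have h0 := normr_ge0 (a - b).
  by rewrite !minElt; case: (ltP 1 a) => ?; case: (ltP 1 b) => ?; apply: abs; lra.
apply: le_trans (lip_min _ _) _; apply: le_trans (lip_max _ _) _.
by rewrite (_ : _ - _ = `|y| - `|x|) 1?distrC//; ring.
Qed.

Lemma cutoff_tail K x : 0 < K -> 1 - cutoff K x <= (K ^+ 2)^-1 * x ^+ 2.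
Proof.
move=> K0; have [xK|Kx] := leP `|x| K.
  by rewrite cutoff_eq1// subrr mulr_ge0 ?invr_ge0 ?sqr_ge0.
apply: (@le_trans _ _ 1); first by rewrite gerBl cutoff_ge0.
rewrite mulrC ler_pdivlMr ?exprn_gt0// mul1r -[x ^+ 2]real_normK ?num_real//.
by rewrite lerXn2r ?nnegrE// ltW.
Qed.

Lemma lipschitz_mul (f g : R -> R) Lf Lg Bf Bg :
  (forall x y, `|f x - f y| <= Lf * `|x - y|) -> (forall x, `|f x| <= Bf) ->
  (forall x y, `|g x - g y| <= Lg * `|x - y|) -> (forall x, `|g x| <= Bg) ->
  forall x y, `|f x * g x - f y * g y| <= (Bf * Lg + Bg * Lf) * `|x - y|.
Proof.
move=> fl fb gl gb x y.
rewrite (_ : _ - _ = f x * (g x - g y) + g y * (f x - f y)); last by ring.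
rewrite mulrDl -!mulrA; apply: le_trans (ler_normD _ _) _.
by rewrite !normrM lerD// ler_pM.
Qed.

End Cutoff.

Section GaussianLimit.
Context {R : realType}.
Notation leb := (@lebesgue_measure R).
Variable v : R.
Variables (dT : nat -> measure_display) (T : forall n, measurableType (dT n)).
Variables (P : forall n, probability (T n) R) (X : forall n, T n -> R).
Arguments X : clear implicits.
Hypothesis mX : forall n, measurable_fun setT (X n).
Variable V : R.
Hypothesis second_moment : \forall n \near \oo, forall (f : R -> R) c B,
  continuous f -> (forall x, `|f x| <= B) -> 0 <= c ->
  (forall x, `|f x| <= c * x ^+ 2) -> `|expect (P n) (X n) f| <= c * V.
Hypothesis stein : forall (f : R -> R) L A, 0 <= A ->
  (forall x y, `|f x - f y| <= L * `|x - y|) -> (forall x, A <= `|x| -> f x = 0) ->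
  \int[leb]_x (f x * gauss_density v x) = 0 ->
  (fun n => expect (P n) (X n) f) @ \oo --> (0 : R).

Let E n := expect (P n) (X n).
Let I := expect (gauss_prob v) id.

Let mid : measurable_fun setT (id : measurableTypeR R -> R).
Proof. exact: measurable_id. Qed.

(** Write [f = f1 + c + r] with [f1 = (f - c) * phi] for a cutoff [phi] and
    [c] chosen such that [f1] is centred under the normal law.  Then [f1] falls
    under [stein], and [r = (f - c) * (1 - phi)] is small under all laws
    involved by the tail bounds; subtracting the decompositions for [P n] and
    for the limit removes [c]. *)
Lemma gaussian_limit (f : R -> R) L B :
  (forall x y, `|f x - f y| <= L * `|x - y|) -> (forall x, `|f x| <= B) ->
  (fun n => expect (P n) (X n) f) @ \oo --> expect (gauss_prob v) id f.
Proof.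
move=> fl fB.
have B0 : 0 <= B by exact: le_trans (normr_ge0 _) (fB 0).
have cf : continuous f by exact: lipschitz_continuous fl.
have V0 : 0 <= V.
  have [m _ /(_ m (leqnn m))] := second_moment.
  move=> /(_ (fun=> 0) 1 0); rewrite mul1r.
  have c0 : continuous (fun _ : R => 0 : R) by move=> x; exact: cvg_cst.
  move=> /(_ c0); rewrite normr0 lexx; move=> /(_ (fun _ => isT) ler01) H.
  by apply: le_trans (normr_ge0 _) (H _) => x; rewrite mul1r sqr_ge0.
have phil K := @cutoff_lip R K.
have phiB (K x : R) : `|cutoff K x| <= 1 by rewrite ger0_norm ?cutoff_ge0// cutoff_le1.
have phic K : continuous (@cutoff R K) by exact: lipschitz_continuous (phil K).
have Iphi : (fun n : nat => I (cutoff n%:R)) @ \oo --> (1 : R).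
  suff : (fun n : nat => I (cutoff n%:R)) @ \oo --> I (fun=> 1).
    by rewrite {2}/I expect_cst.
  apply: (expect_cvg (B := 1) mid) => //.
    by move=> x; exact: cvg_cst.
  move=> x; apply: cvg_near_cst; near=> n; apply: cutoff_eq1.
  near: n; exact: nbhs_infty_ger.
apply/cvgrPdist_le => e e0.
(* [K] makes the mass outside [-K, K] small under the limit and under all [P n] *)
have [K [K0 KI KV]] : exists K : R, [/\ 0 < K,
      1 - I (cutoff K) <= Num.min (1/2) (e / (8 * (B + 1)))
    & (K ^+ 2)^-1 * V <= e / (8 * (B + 1))].
  have e8 : 0 < e / (8 * (B + 1)) by rewrite divr_gt0// mulr_gt0// ltr_wpDl.
  have mn : 0 < Num.min (1/2) (e / (8 * (B + 1))) by rewrite lt_min e8 divr_gt0.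
  have /cvgrPdist_le /(_ _ mn) near_I := Iphi.
  near \oo => n; exists n%:R; split.
  - by rewrite ltr0n; near: n; exact: nbhs_infty_gt.
  - by apply: le_trans (ler_norm _) _; near: n; exact: near_I.
  - have n1 : 1 <= n%:R :> R by rewrite ler1n; near: n; exact: nbhs_infty_gt.
    have n0 : 0 < n%:R :> R by rewrite (lt_le_trans ltr01).
    have nV : V / (e / (8 * (B + 1))) <= n%:R by near: n; exact: nbhs_infty_ger.
    rewrite mulrC ler_pdivrMr ?exprn_gt0// mulrC -ler_pdivrMr//.
    by apply: le_trans nV _; rewrite expr2 ler_peMl// ltW.
pose phi := @cutoff R K.
have Iphi0 : 1 / 2 <= I phi.
  by move: KI; rewrite le_min => /andP[+ _]; rewrite -/phi; lra.
have Ipos : 0 < I phi by apply: lt_le_trans Iphi0; rewrite divr_gt0.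
pose fphi x := f x * phi x.
have fphic : continuous fphi by move=> x; apply: cvgM; [exact: cf|exact: phic].
have fphiB x : `|fphi x| <= B.
  by rewrite /fphi normrM -[B]mulr1 (ler_pM _ _ (fB x) (phiB K x)).
(* since [0 <= phi] this weighted mean of [f] is bounded by [B] *)
pose c := I fphi / I phi.
have cB : `|c| <= B.
  rewrite normrM [`|(I phi)^-1|]gtr0_norm ?invr_gt0// ler_pdivrMr//.
  have cBphi : continuous (fun x => B * phi x).
    by move=> x; apply: cvgMl_tmp; exact: phic.
  have BphiB x : `|B * phi x| <= B by rewrite normrM ger0_norm// ler_piMr// (phiB K x).
  have cBphi' : continuous (fun x => - B * phi x).
    by move=> x; apply: cvgMl_tmp; exact: phic.
  have BphiB' x : `|- B * phi x| <= B by rewrite mulNr normrN.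
  rewrite ler_norml -mulNr -!(expectZ _ mid _ (phic K) (phiB K)).
  apply/andP; split.
    apply: (le_expect _ mid cBphi' BphiB' fphic fphiB) => x.
    rewrite /fphi ler_wpM2r ?cutoff_ge0//.
    by have := fB x; rewrite ler_norml => /andP[].
  apply: (le_expect _ mid fphic fphiB cBphi BphiB) => x.
  rewrite /fphi ler_wpM2r ?cutoff_ge0//.
  exact: le_trans (ler_norm _) (fB x).
pose fc x := f x - c.
have fcl x y : `|fc x - fc y| <= L * `|x - y|.
  by rewrite (_ : fc x - fc y = f x - f y); [exact: fl|rewrite /fc; ring].
have fcB x : `|fc x| <= B + B by apply: le_trans (ler_normB _ _) (lerD (fB x) cB).
have fcc : continuous fc by exact: lipschitz_continuous fcl.
pose f1 x := fc x * phi x.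
pose r x := fc x * (1 - phi x).
have f1l := lipschitz_mul fcl fcB (phil K) (phiB K).
have f1c : continuous f1 by exact: lipschitz_continuous f1l.
have BB0 : 0 <= B + B by rewrite addr_ge0.
have f1B x : `|f1 x| <= B + B.
  by rewrite /f1 normrM -[B + B]mulr1 (ler_pM _ _ (fcB x) (phiB K x)).
have phi1 x : 0 <= 1 - phi x <= 1.
  by rewrite subr_ge0 cutoff_le1 gerBl cutoff_ge0.
have rB' x : `|r x| <= (B + B) * (1 - phi x).
  have /andP[p0 _] := phi1 x.
  by rewrite /r normrM (ger0_norm p0) ler_wpM2r.
have rB x : `|r x| <= B + B.
  have /andP[_ p1] := phi1 x.
  by apply: le_trans (rB' x) _; rewrite ler_piMr.
have rc : continuous r.
  move=> x; apply: cvgM; first exact: fcc.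
  by apply: cvgB; [exact: cvg_cst|exact: phic].
have f1I : I f1 = 0.
  have -> : f1 = fun x => fphi x + (- c) * phi x.
    by apply/funext => x; rewrite /f1 /fc /fphi; ring.
  have cphic : continuous (fun x => - c * phi x).
    by move=> x; apply: cvgMl_tmp; exact: phic.
  have cphiB x : `|- c * phi x| <= `|c| * 1.
    by rewrite normrM normrN ler_wpM2l// (phiB K x).
  rewrite /I (expectD _ mid fphic fphiB cphic cphiB) (expectZ _ mid _ (phic K) (phiB K)).
  by rewrite mulNr /c divfK ?subrr// gt_eqF.
have split_expect d' (T' : measurableType d') (P' : probability T' R) (X' : T' -> R) :
    measurable_fun setT X' -> expect P' X' f = expect P' X' f1 + c + expect P' X' r.
  move=> mX'; have cc : continuous (fun _ : R => c) by move=> x; exact: cvg_cst.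
  rewrite -[in RHS](expect_cst P' X' c).
  rewrite -(expectD _ mX' f1c f1B cc (fun _ => lexx _)).
  have f1cc : continuous (fun x => f1 x + c).
    by move=> x; apply: cvgD; [exact: f1c|exact: cvg_cst].
  have f1cB x : `|f1 x + c| <= B + B + B.
    by apply: le_trans (ler_normD _ _) (lerD (f1B x) cB).
  rewrite -(expectD _ mX' f1cc f1cB rc rB); congr expect.
  by apply/funext => x; rewrite /f1 /r /fc; ring.
have f1_0 : (fun n => E n f1) @ \oo --> (0 : R).
  apply: (stein (L := (B + B) * 1 + 1 * L) (A := K + 1)) => //.
  - by rewrite addr_ge0// ltW.
  - by move=> x Kx; rewrite /f1 /phi cutoff_eq0// mulr0.
  - by rewrite -(@expect_normal R v _ _ f1c f1B).
have e4 : 0 < e / 4 by rewrite divr_gt0.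
have key : (B + B) * (e / (8 * (B + 1))) <= e / 4.
  rewrite mulrA ler_pdivrMr ?mulr_gt0 ?ltr_wpDl//.
  by have := mulr_ge0 (ltW e0) B0; nra.
have Ir : `|I r| <= e / 4.
  have c1' : continuous (fun x => -1 * phi x).
    by move=> x; apply: cvgMl_tmp; exact: phic.
  have c1 : continuous (fun x => 1 + -1 * phi x).
    by move=> x; apply: cvgD; [exact: cvg_cst|exact: c1'].
  have c2 : continuous (fun x => (B + B) * (1 + -1 * phi x)).
    by move=> x; apply: cvgMl_tmp; exact: c1.
  have b1' x : `|-1 * phi x| <= 1 by rewrite mulN1r normrN phiB.
  have b1 x : `|1 + -1 * phi x| <= 1.
    by have := phi1 x; rewrite mulN1r => /andP[h1 h2]; rewrite ger0_norm.
  have b2 x : `|(B + B) * (1 + -1 * phi x)| <= B + B.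
    by rewrite normrM (ger0_norm BB0) ler_piMr.
  have le x : `|r x| <= (B + B) * (1 + -1 * phi x) by rewrite mulN1r.
  apply: le_trans (expect_norm_le _ mid rc c2 b2 le) _.
  have cc : continuous (fun _ : R => 1 : R) by move=> x; exact: cvg_cst.
  rewrite (expectZ _ mid _ c1 b1) (expectD _ mid cc (fun _ => lexx _) c1' b1').
  rewrite expect_cst (expectZ _ mid _ (phic K) (phiB K)).
  apply: le_trans key; rewrite ler_wpM2l// mulN1r.
  by move: KI; rewrite le_min => /andP[].
have rx x : `|r x| <= (B + B) * (K ^+ 2)^-1 * x ^+ 2.
  by apply: le_trans (rB' x) _; rewrite -mulrA ler_wpM2l// cutoff_tail.
have f1_0' : \forall n \near \oo, `|0 - E n f1| <= e / 4.
  by move/cvgrPdist_le: f1_0 => /(_ _ e4).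
have Er_near : \forall n \near \oo, `|E n r| <= (B + B) * (K ^+ 2)^-1 * V.
  have c0 : 0 <= (B + B) * (K ^+ 2)^-1 by rewrite mulr_ge0// invr_ge0 sqr_ge0.
  by move: second_moment; apply: filterS => n Hn; exact: (Hn r _ (B + B)).
near=> n.
have Er : `|E n r| <= e / 4.
  apply: (@le_trans _ _ ((B + B) * (K ^+ 2)^-1 * V)); first by near: n.
  by apply: le_trans key; rewrite -mulrA ler_wpM2l.
have E1 : `|0 - E n f1| <= e / 4 by near: n; exact: f1_0'.
rewrite /= (split_expect _ _ (gauss_prob v) id mid) -/I f1I.
rewrite (split_expect _ _ (P n) (X n) (@mX n)) -/(E n f1) -/(E n r).
rewrite (_ : _ - _ = I r - E n r + (0 - E n f1)); last by ring.
apply: le_trans (ler_normD _ _) _.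
apply: le_trans (lerD (le_trans (ler_normB _ _) (lerD Ir Er)) E1) _.
by lra.
Unshelve. all: by end_near. Qed.

End GaussianLimit.

(** * Second moment and Stein estimates for the stationary number of jobs *)

Section StationaryEstimates.
Context {R : realType} {d : nat}.
Variables (Q : 'M[R]_d) (lam : 'rV[R]_d) (mu : R) (g r : 'I_d -> R) (linf U : R).
Hypothesis Q0 : forall i, \sum_j Q i j = 0.
Hypothesis Qg : forall i, \sum_j Q i j * g j = linf - lam 0 i.
Hypothesis Qr : forall i,
  \sum_j Q i j * r j = U - g i * (lam 0 i - linf).
Hypothesis lam0 : forall i, 0 <= lam 0 i.
Hypothesis linf0 : 0 <= linf.
Hypothesis mu0 : 0 < mu.
Variables (B ell : R).
Hypothesis gB : forall i, `|g i| <= B.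
Hypothesis rB : forall i, `|r i| <= B.
Hypothesis lam_ell : forall i, lam 0 i <= ell.
Hypothesis B0 : 0 <= B.
Hypothesis ell0 : 0 <= ell.
Variables (nn s del : R).
Hypothesis nn0 : 0 < nn.
Hypothesis s0 : 0 < s.
Hypothesis del0 : 0 < del.
Hypothesis nndel2 : nn * del ^+ 2 <= 1.
Hypothesis nn2del2 : nn ^+ 2 * del ^+ 2 / s <= 1.
Hypothesis nndel : 1 <= nn * del.
Variable p : 'I_d -> nat -> R.
Hypothesis p0 : forall i k, 0 <= p i k.
Hypothesis p_sub : subinvariant (s *: Q) (nn *: lam) mu p.

Let x := scaled_jobs mu linf nn del.

(** Means over the levels below [n]: every identity is used at finite [n], where
    sums are finite, and [n] tends to infinity at the very end. *)
Definition mean n (f : R -> R) := weighted_sum p n (fun _ k => f (x k)).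

Hypothesis mass : (fun n => mean n (fun=> 1)) @ \oo --> (1 : R).

Definition expansion_error := expansion_const mu linf B ell * (del + nn * del / s).
Let eta := expansion_error.
Let sN := scaled_variance linf U nn s del.

Lemma expansion_error_ge0 : 0 <= expansion_error.
Proof.
rewrite mulr_ge0 ?expansion_const_ge0 ?addr_ge0 ?divr_ge0 ?mulr_ge0//; exact: ltW.
Qed.

Let generator_mean h h1 h2 n : R := weighted_sum p n
  (jobs_generator (s *: Q) (nn *: lam) mu
    (corrected_test mu g r linf nn s del h h1 h2)).

Lemma meanD n f1 f2 : mean n (fun y => f1 y + f2 y) = mean n f1 + mean n f2.
Proof.
rewrite /mean /weighted_sum -big_split; apply: eq_bigr => k _ /=.
by rewrite -big_split; apply: eq_bigr => i _ /=; rewrite mulrDr.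
Qed.

Lemma meanZ n c f : mean n (fun y => c * f y) = c * mean n f.
Proof. exact: (weighted_sumZ p n c (fun _ k => f (x k))). Qed.

Lemma ler_mean n f1 f2 : (forall y, f1 y <= f2 y) -> mean n f1 <= mean n f2.
Proof. by move=> H; apply: ler_weighted_sum. Qed.

Lemma ler_norm_mean n f f2 : (forall y, `|f y| <= f2 y) -> `|mean n f| <= mean n f2.
Proof.
move=> H; apply: le_trans (ler_norm_weighted_sum _ _ p0) _.
exact: ler_weighted_sum.
Qed.

Lemma generator_mean_cvg0 K C h h1 h2 : test_function K C h h1 h2 -> 0 <= C ->
  generator_mean h h1 h2 @ \oo --> (0 : R).
Proof.
move=> hP C0.
have [C' HC'] := corrected_test_growth linf0 mu0 gB rB nn0 s0 del0
  nndel2 nn2del2 hP C0.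
apply: jobs_balance HC' => //.
- by move=> i; under eq_bigr do rewrite mxE; rewrite -mulr_sumr Q0 mulr0.
- by move=> i; rewrite mxE mulr_ge0// ltW.
Qed.

(** Stationarity makes the mean of the generator negligible, hence so is the
    mean of its main part, up to the expansion error. *)
Lemma mean_generator_approx K C h h1 h2 n : test_function K C h h1 h2 ->
  `|mean n (fun y => - mu * (y * h1 y) + sN * h2 y)| <=
  `|generator_mean h h1 h2 n| + eta * mean n (fun y => (1 + `|y|) * (K + `|h2 y|)).
Proof.
move=> hP; rewrite -meanZ -lerBlDl.
apply: le_trans (lerB_dist _ _) _; rewrite distrC -weighted_sumB.
apply: le_trans (ler_norm_weighted_sum _ _ p0) _.
apply: ler_weighted_sum => // i k.
exact: (generator_approx Q0 Qg Qr lam0 linf0 mu0 gB rB lam_ell B0 ell0 nn0 s0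
  del0 nndel2 nn2del2 nndel hP i k).
Qed.

Hypothesis eta_mu : eta < mu.

Definition second_moment_bound := (sN + 2 * eta) / (mu - eta).

Let errn := generator_mean (fun y => y ^+ 2 / 2) id (fun=> 1).
Let Vn n := (sN * mean n (fun=> 1) + 2 * eta * mean n (fun=> 1) + `|errn n|)
  / (mu - eta).

Let Vn_cvg : Vn @ \oo --> second_moment_bound.
Proof.
rewrite /second_moment_bound; apply: cvgMr_tmp.
rewrite -[X in _ --> X]addr0 -{2}[sN]mulr1 -{2}[2 * eta]mulr1; apply: cvgD; last first.
  apply/norm_cvg0P/(generator_mean_cvg0 (@test_function_square R)).
  exact: ler01.
by apply: cvgD; apply: cvgMl_tmp.
Qed.

Let abs_le_sq (y : R) : `|y| <= 1 + y ^+ 2.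
Proof.
rewrite -[y ^+ 2]real_normK ?num_real//.
by have := normr_ge0 y; move: `|y| => z; nra.
Qed.

Lemma mean_abs_le n : mean n (fun y => 1 + `|y|) <=
  2 * mean n (fun=> 1) + mean n (fun y => y ^+ 2).
Proof.
rewrite -meanZ -meanD; apply: ler_mean => y.
by have := abs_le_sq y; lra.
Qed.

(** The case [h = x ^+ 2 / 2], whose main part is [- mu * x ^+ 2 + sN]. *)
Lemma mean_sq_le n : mean n (fun y => y ^+ 2) <= Vn n.
Proof.
rewrite /Vn ler_pdivlMr ?subr_gt0//.
have := mean_generator_approx n (@test_function_square R).
have -> : mean n (fun y => - mu * (y * id y) + sN * 1) =
    - mu * mean n (fun y => y ^+ 2) + sN * mean n (fun=> 1).
  by rewrite -!meanZ -meanD.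
have -> : mean n (fun y => (1 + `|y|) * (0 + `|1|)) = mean n (fun y => 1 + `|y|).
  by congr mean; apply/funext => y; rewrite normr1 add0r mulr1.
have := ler_wpM2l expansion_error_ge0 (mean_abs_le n); rewrite -/eta -/(errn n).
rewrite ler_norml => h1 /andP[h2 _].
by move: (mean n (fun y => y ^+ 2)) (mean n (fun=> 1)) (mean n _) h1 h2 => a b c; lra.
Qed.

Lemma limit_second_moment (f : R -> R) c0 c l : 0 <= c ->
  (forall y, `|f y| <= c0 + c * y ^+ 2) ->
  (fun n => mean n f) @ \oo --> l -> `|l| <= c0 + c * second_moment_bound.
Proof.
move=> cge fc fl.
have cv : (fun n => c0 * mean n (fun=> 1) + c * Vn n) @ \oo -->
    c0 * 1 + c * second_moment_bound.
  by apply: cvgD; apply: cvgMl_tmp => //; exact: Vn_cvg.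
have cvn : (fun n => `|mean n f|) @ \oo --> `|l| by apply: cvg_norm.
rewrite mulr1 in cv; apply: (ler_cvg_to cvn cv).
apply: nearW => n; apply: le_trans (ler_norm_mean n fc) _.
have -> : mean n (fun y => c0 + c * y ^+ 2) =
    c0 * mean n (fun=> 1) + c * mean n (fun y => y ^+ 2).
  rewrite -!meanZ -meanD; congr mean; apply/funext => y; by rewrite mulr1.
by rewrite lerD2l ler_wpM2l// mean_sq_le.
Qed.

(** With [f = v * h2 - y * h1], the main part [- mu * y * h1 + sN * h2] equals
    [mu * f] up to [(sN - mu * v) * h2]. *)
Lemma limit_stein (f h h1 h2 : R -> R) (v K C B2 l : R) :
  test_function K C h h1 h2 -> (forall y, `|h2 y| <= B2) ->
  (forall y, v * h2 y - y * h1 y = f y) ->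
  (fun n => mean n f) @ \oo --> l ->
  mu * `|l| <= `|sN - mu * v| * B2
     + eta * ((K + B2) * (2 + second_moment_bound)).
Proof.
move=> hP hB2 hf fl.
have K0 := test_function_ge0 hP.
have B20 : 0 <= B2 by exact: le_trans (normr_ge0 _) (hB2 0).
have C0 : 0 <= C.
  have [_ _ _ /(_ 0) [+ _ _]] := hP; rewrite normr0 addr0 expr1n mulr1.
  exact: le_trans.
have eta0 : 0 <= eta by exact: expansion_error_ge0.
pose bn n := `|generator_mean h h1 h2 n|
   + `|sN - mu * v| * (B2 * mean n (fun=> 1))
   + eta * ((K + B2) * (2 * mean n (fun=> 1) + Vn n)).
have cv : bn @ \oo --> 0 + `|sN - mu * v| * (B2 * 1)
     + eta * ((K + B2) * (2 * 1 + second_moment_bound)).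
  apply: cvgD; last first.
    by apply: cvgMl_tmp; apply: cvgMl_tmp; apply: cvgD; [exact: cvgMl_tmp|exact: Vn_cvg].
  apply: cvgD; last by apply: cvgMl_tmp; apply: cvgMl_tmp.
  by apply/norm_cvg0P; exact: generator_mean_cvg0 hP C0.
rewrite add0r !mulr1 in cv.
have cvn : (fun n => mu * `|mean n f|) @ \oo --> mu * `|l|.
  by apply: cvgMl_tmp; apply: cvg_norm.
apply: (ler_cvg_to cvn cv); apply: nearW => n.
rewrite -{1}(gtr0_norm mu0) -normrM -meanZ.
have -> : mean n (fun y => mu * f y) =
    mean n (fun y => - mu * (y * h1 y) + sN * h2 y)
    + mean n (fun y => (mu * v - sN) * h2 y).
  by rewrite -meanD; congr mean; apply/funext => y; rewrite -hf; ring.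
apply: le_trans (ler_normD _ _) _.
have b1 := mean_generator_approx n hP.
have b2 : `|mean n (fun y => (mu * v - sN) * h2 y)| <=
    `|sN - mu * v| * (B2 * mean n (fun=> 1)).
  rewrite -!meanZ; apply: ler_norm_mean => y; rewrite normrM distrC mulr1.
  exact: ler_wpM2l.
have b3 : mean n (fun y => (1 + `|y|) * (K + `|h2 y|)) <=
    (K + B2) * (2 * mean n (fun=> 1) + Vn n).
  apply: (@le_trans _ _ ((K + B2) * mean n (fun y => 1 + `|y|))).
    rewrite -meanZ; apply: ler_mean => y; rewrite mulrC ler_wpM2r ?addr_ge0//.
    by rewrite lerD2l.
  rewrite ler_wpM2l ?addr_ge0//; apply: le_trans (mean_abs_le n) _.
  by rewrite lerD2l mean_sq_le.
have b3' := ler_wpM2l eta0 b3.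
apply: le_trans (lerD b1 b2) _; rewrite /bn addrAC.
by rewrite lerD2l.
Qed.

End StationaryEstimates.

(** * Powers of the scaling parameter and conclusion *)

Section PowerAsymptotics.
Context {R : realType}.

Lemma nat_powR_cvg0 (e : R) : e < 0 -> (fun n : nat => n%:R `^ e) @ \oo --> (0 : R).
Proof.
move=> e0; apply/cvgrPdist_le => eps eps0.
near=> n.
have n0 : 0 < n%:R :> R by rewrite ltr0n; near: n; exact: nbhs_infty_gt.
have ne0 : 0 < - e by rewrite oppr_gt0.
rewrite sub0r normrN ger0_norm ?powR_ge0// -[e]opprK powRN.
rewrite -[eps]invrK lef_pV2 ?posrE ?powR_gt0 ?invr_gt0//.
have : eps^-1 `^ ((- e)^-1) <= n%:R by near: n; exact: nbhs_infty_ger.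
move=> /(ge0_ler_powR (ltW ne0)); rewrite !nnegrE powR_ge0 => /(_ isT (ltW n0)).
by rewrite -powRrM mulVf ?gt_eqF// powRr1// invr_ge0 ltW.
Unshelve. all: by end_near. Qed.

Lemma nat_powR_le1 (n : nat) (e : R) : (0 < n)%N -> e <= 0 -> n%:R `^ e <= 1.
Proof.
move=> n0 e0; have n1 : 1 <= n%:R :> R by rewrite ler1n.
by have := ler_powR n1 e0; rewrite powRr0.
Qed.

Lemma nat_powR_ge1 (n : nat) (e : R) : (0 < n)%N -> 0 <= e -> 1 <= n%:R `^ e.
Proof.
move=> n0 e0; have n1 : 1 <= n%:R :> R by rewrite ler1n.
by have := ler_powR n1 e0; rewrite powRr0.
Qed.

Lemma nat_powR_cvg (e : R) : e <= 0 ->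
  (fun n : nat => n%:R `^ e) @ \oo --> ((e == 0)%:R : R).
Proof.
rewrite le_eqVlt => /orP[/eqP ->|e0].
  rewrite eqxx; apply: cvg_near_cst; near=> n; exact: powRr0.
by rewrite lt_eqF//; exact: nat_powR_cvg0.
Unshelve. all: by end_near. Qed.

End PowerAsymptotics.

Section Scaling.
Context {R : realType}.
Variables alpha gamma : R.
Variable n : nat.
Hypothesis n0 : (0 < n)%N.
Let nn : R := n%:R.
Let s : R := nn `^ alpha.
Let del : R := (nn `^ gamma)^-1.

Let nn0 : 0 < nn. Proof. by rewrite ltr0n. Qed.

Lemma scaling_del : del = nn `^ (- gamma).
Proof. by rewrite powRN. Qed.

Let nnD e1 e2 : nn `^ e1 * nn `^ e2 = nn `^ (e1 + e2).
Proof. by rewrite powRD// (gt_eqF nn0) implybT. Qed.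

Lemma scaling_ndel : nn * del = nn `^ (1 - gamma).
Proof. by rewrite scaling_del -{1}[nn]powRr1 ?(ltW nn0)// nnD. Qed.

Lemma scaling_ndel2 : nn * del ^+ 2 = nn `^ (1 - 2 * gamma).
Proof. by rewrite expr2 mulrA scaling_ndel scaling_del nnD; congr (_ `^ _); ring. Qed.

Lemma scaling_n2del2 : nn ^+ 2 * del ^+ 2 / s = nn `^ (2 - alpha - 2 * gamma).
Proof. by rewrite -exprMn scaling_ndel expr2 -powRN !nnD; congr (_ `^ _); ring. Qed.

Lemma scaling_ndel_speed : nn * del / s = nn `^ (1 - gamma - alpha).
Proof. by rewrite scaling_ndel -powRN nnD. Qed.

End Scaling.

Theorem corollary1 (R : realType) (d : nat)
  (Q : 'M[R]_d) (J : markov_process (fun i j : 'I_d => Q i j))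
  (J_irreducible : irreducible_process J)
  (varpi : 'cV[R]_d)
  (varpi_stationary : stationary_distribution J (fun i => varpi i 0))
  (lambda : 'rV[R]_d) (lambda_ge0 : forall i, 0 <= lambda 0 i)
  (mu : R) (mu_gt0 : 0 < mu)
  (alpha : R) (alpha_gt0 : 0 < alpha)
  (model : queue_model)
  (dT : nat -> measure_display) (T : forall N, measurableType (dT N))
  (P : forall N, probability (T N) R) (M : forall N, {RV (P N) >-> nat})
  (M_stationary : forall N, (0 < N)%N ->
     stationary_number_of_jobs model
       (N%:R `^ alpha *: Q) (N%:R *: lambda) (const_mx mu) (M N)) :
  let D := deviation_matrix J varpi in
  let Lambda := diag_mx lambda in
  let lambda_infty := \sum_(i < d) varpi i 0 * lambda 0 i in
  let rho := lambda_infty / mu in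
  let U := (varpi^T *m Lambda *m D *m Lambda *m (const_mx 1 : 'cV[R]_d)) 0 0 in
  let gamma : R := Num.max (1 - alpha / 2) (1 / 2) in
  let sigma2_m := mu^-1 * U in
  let sigma2 := sigma2_m * (alpha <= 1)%R%:R + rho * (1 <= alpha)%R%:R in
  cvg_in_distribution P
    (fun N w => ((M N w)%:R - N%:R * rho) / N%:R `^ gamma)
    (normal_law 0 sigma2).
Proof.
move=> D Lambda linf rho U gamma sigma2_m sigma2.
have Q0 := rates_row_sum J.
have linf0 : 0 <= linf.
  by apply: sumr_ge0 => i _; rewrite mulr_ge0//; case: varpi_stationary.
(* [g] corrects the drift, [r] the coefficient of the second derivative *)
pose g i := \sum_j D i j * lambda 0 j.
pose r i := \sum_j D i j * (g j * (lambda 0 j - linf)).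
have Qg i : \sum_j Q i j * g j = linf - lambda 0 i
  by exact: (poisson_equation J_irreducible varpi_stationary).
have varpi_g : \sum_k varpi k 0 * g k = 0
  by exact: (poisson_equation_centred J_irreducible varpi_stationary).
have UE : U = \sum_k varpi k 0 * (g k * lambda 0 k).
  rewrite /U -!mulmxA mxE; apply: eq_bigr => k _; rewrite [_^T _ _]mxE.
  congr (_ * _); rewrite mul_diag_mx mxE mulrC; congr (_ * _).
  rewrite mxE; apply: eq_bigr => j _; congr (_ * _).
  by rewrite mul_diag_mx !mxE mulr1.
have Qr i : \sum_j Q i j * r j = U - g i * (lambda 0 i - linf).
  rewrite (poisson_equation J_irreducible varpi_stationary); congr (_ - _).
  under eq_bigr do rewrite mulrBr mulrBr (mulrA _ (g _) linf).
  by rewrite sumrB -mulr_suml varpi_g mul0r subr0 UE.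
pose ell := \sum_i lambda 0 i.
have lam_ell i : lambda 0 i <= ell.
  by rewrite /ell (bigD1 i)//= lerDl sumr_ge0.
have ell0 : 0 <= ell by rewrite sumr_ge0.
pose B := \sum_i `|g i| + \sum_i `|r i|.
have gB i : `|g i| <= B.
  by rewrite /B (bigD1 i)//= -addrA lerDl addr_ge0 ?sumr_ge0.
have rB i : `|r i| <= B.
  by rewrite /B addrC (bigD1 i)//= -addrA lerDl addr_ge0 ?sumr_ge0.
have B0 : 0 <= B by rewrite addr_ge0 ?sumr_ge0.
(* signs of the exponents of [N] in [del], [nn * del], [nn * del ^+ 2],
   [nn ^+ 2 * del ^+ 2 / s] and [nn * del / s] *)
have gE : [/\ 0 < gamma, 0 <= 1 - gamma, 1 - 2 * gamma <= 0
   & 2 - alpha - 2 * gamma <= 0] /\ [/\ 1 - gamma - alpha < 0,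
     (1 - 2 * gamma == 0) = (1 <= alpha)
   & (2 - alpha - 2 * gamma == 0) = (alpha <= 1)].
  rewrite /gamma; case: (leP (1 - alpha / 2) (1 / 2)) => h.
    by split; split; [lra|lra|lra|lra|lra|apply/eqP/idP => ?; lra
      |apply/eqP/idP => ?; lra].
  by split; split; [lra|lra|lra|lra|lra|apply/eqP/idP => ?; lra
    |apply/eqP/idP => ?; lra].
have [[g0 g1 g2 g3] [g4 g5 g6]] := gE.
pose del (N : nat) : R := (N%:R `^ gamma)^-1.
pose s (N : nat) : R := N%:R `^ alpha.
pose X N w : R := ((M N w)%:R - N%:R * rho) / N%:R `^ gamma.
have mX N : measurable_fun setT (X N).
  exact: (measurable_nat_comp (M N) (fun k => (k%:R - N%:R * rho) / N%:R `^ gamma)).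
pose sN N := scaled_variance linf U N%:R (s N) (del N).
pose eta N := expansion_error mu linf B ell N%:R (s N) (del N).
pose V N := second_moment_bound mu linf U B ell N%:R (s N) (del N).
have sN_cvg : sN @ \oo --> mu * sigma2.
  have -> : mu * sigma2 = (1 - 2 * gamma == 0)%:R * linf
      + (2 - alpha - 2 * gamma == 0)%:R * U.
    by rewrite g5 g6 /sigma2 /sigma2_m /rho; field; rewrite gt_eqF.
  have : (fun N : nat => N%:R `^ (1 - 2 * gamma) * linf
      + N%:R `^ (2 - alpha - 2 * gamma) * U) @ \oo -->
      (1 - 2 * gamma == 0)%:R * linf + (2 - alpha - 2 * gamma == 0)%:R * U.
    by apply: cvgD; apply: cvgMr_tmp; exact: nat_powR_cvg.
  apply: cvg_trans; apply: near_eq_cvg; near=> N.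
  have N0 : (0 < N)%N by near: N; exact: nbhs_infty_gt.
  by rewrite /sN /scaled_variance /s /del scaling_ndel2// scaling_n2del2.
have eta_cvg : eta @ \oo --> (0 : R).
  have : (fun N : nat => expansion_const mu linf B ell *
      (N%:R `^ (- gamma) + N%:R `^ (1 - gamma - alpha))) @ \oo -->
      expansion_const mu linf B ell * (0 + 0).
    apply: cvgMl_tmp; apply: cvgD; apply: nat_powR_cvg0 => //.
    by rewrite oppr_lt0.
  rewrite addr0 mulr0; apply: cvg_trans; apply: near_eq_cvg; near=> N.
  have N0 : (0 < N)%N by near: N; exact: nbhs_infty_gt.
  by rewrite /eta /expansion_error /s /del scaling_ndel_speed// scaling_del.
have V_cvg : V @ \oo --> sigma2.
  have -> : sigma2 = (mu * sigma2 + 2 * 0) / (mu - 0) by field; rewrite gt_eqF.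
  apply: cvgM; first by apply: cvgD => //; exact: cvgMl_tmp.
  by apply: cvgV; [rewrite subr0 gt_eqF|apply: cvgB => //; exact: cvg_cst].
pose moment_estimate N := forall (f : R -> R) c0 c Bf, continuous f ->
  (forall x, `|f x| <= Bf) -> 0 <= c -> (forall x, `|f x| <= c0 + c * x ^+ 2) ->
  `|expect (P N) (X N) f| <= c0 + c * V N.
pose stein_estimate N := forall (f h h1 h2 : R -> R) v K C B2 Bf, continuous f ->
  (forall x, `|f x| <= Bf) -> test_function K C h h1 h2 ->
  (forall y, `|h2 y| <= B2) -> (forall y, v * h2 y - y * h1 y = f y) ->
  mu * `|expect (P N) (X N) f| <=
    `|sN N - mu * v| * B2 + eta N * ((K + B2) * (2 + V N)).
have est : \forall N \near \oo, moment_estimate N /\ stein_estimate N.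
  near=> N.
  have N0 : (0 < N)%N by near: N; exact: nbhs_infty_gt.
  have eta_mu : eta N < mu.
    by near: N; move/cvgr_lt : eta_cvg; exact.
  have nn0 : 0 < N%:R :> R by rewrite ltr0n.
  have s0 : 0 < s N by rewrite powR_gt0.
  have del0 : 0 < del N by rewrite invr_gt0 powR_gt0.
  have h1 : N%:R * del N ^+ 2 <= 1 by rewrite scaling_ndel2// nat_powR_le1.
  have h2 : N%:R ^+ 2 * del N ^+ 2 / s N <= 1.
    by rewrite scaling_n2del2// nat_powR_le1.
  have h3 : 1 <= N%:R * del N by rewrite scaling_ndel// nat_powR_ge1.
  have [p [p0 pM psub]] := stationary_level_weights (M_stationary N N0).
  have series (f : R -> R) Bf : continuous f -> (forall x, `|f x| <= Bf) ->
      (fun n => mean mu linf N%:R (del N) p n f) @ \oo --> expect (P N) (X N) f.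
    move=> cf fB; rewrite /mean /weighted_sum.
    under eq_fun do under eq_bigr do rewrite -mulr_suml.
    pose F k := f ((k%:R - N%:R * rho) / N%:R `^ gamma).
    exact: (Rintegral_nat_series (F := F) pM (fun k => fB _)).
  have mass : (fun n => mean mu linf N%:R (del N) p n (fun=> 1)) @ \oo --> (1 : R).
    have c1 : continuous (fun _ : R => 1 : R) by move=> x; exact: cvg_cst.
    by have := series _ `|1| c1 (fun _ => lexx _); rewrite expect_cst.
  split.
    move=> f c0 c Bf cf fB c_ge0 fc.
    exact: (limit_second_moment Q0 Qg Qr lambda_ge0 linf0 mu_gt0 gB rB lam_ell B0
      ell0 nn0 s0 del0 h1 h2 h3 p0 psub mass eta_mu c_ge0 fc (series _ _ cf fB)).
  move=> f h k1 k2 v K C B2 Bf cf fB hP hB2 hf.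
  exact: (limit_stein Q0 Qg Qr lambda_ge0 linf0 mu_gt0 gB rB lam_ell B0
      ell0 nn0 s0 del0 h1 h2 h3 p0 psub mass eta_mu hP hB2 hf (series _ _ cf fB)).
have moment_est : \forall N \near \oo, moment_estimate N.
  by apply: filterS est => N [].
have stein_est : \forall N \near \oo, stein_estimate N.
  by apply: filterS est => N [].
(* a limit of upper bounds for second moments *)
have sigma2_ge0 : 0 <= sigma2.
  rewrite -(cvg_lim (@Rhausdorff R) V_cvg); apply: limr_ge.
    by apply/cvg_ex; exists sigma2.
  apply: filterS moment_est => N H.
  have c00 : continuous (fun _ : R => 0 : R) by move=> x; exact: cvg_cst.
  have := H (fun=> 0) 0 1 0 c00.
  rewrite normr0 lexx => /(_ (fun _ => isT) ler01); rewrite add0r mul1r => H1.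
  by apply: le_trans (normr_ge0 _) (H1 _) => x; rewrite add0r mul1r sqr_ge0.
rewrite /normal_law; have [sigma0|sigma_neq0] := eqVneq sigma2 0.
  (* the second moments tend to [sigma2 = 0], so the laws concentrate at 0 *)
  pose nu : probability (measurableTypeR R) R := dirac (0 : measurableTypeR R).
  apply: (cvg_in_distribution_of_lipschitz (nu := nu)) => // f L Bf fl fB.
  have cf := lipschitz_continuous fl.
  have mid : measurable_fun setT (id : measurableTypeR R -> R).
    exact: measurable_id.
  have -> : expect nu id f = f 0.
    rewrite /expect /Rintegral integral_dirac//=; last first.
      by apply/measurable_EFinP; exact: continuous_measurable_fun.
    by rewrite indicT mul1r.
  have L0 : 0 <= L.
    by have := fl 1 0; rewrite subr0 normr1 mulr1; apply: le_trans.
  pose f0 x := f x + - f 0.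
  have cc : continuous (fun _ : R => - f 0) by move=> x; exact: cvg_cst.
  have cf0 : continuous f0 by move=> x; apply: cvgD; [exact: cf|exact: cc].
  have f0B x : `|f0 x| <= Bf + Bf by apply: le_trans (ler_normB _ _) (lerD _ _).
  apply/cvgrPdist_le => e e0.
  have e2 : 0 < e / 2 by rewrite divr_gt0.
  pose c := L ^+ 2 / (2 * e).
  have c0 : 0 <= c by rewrite divr_ge0 ?sqr_ge0 ?mulr_ge0// ltW.
  (* Young's inequality: L |x| <= e/2 + c x^2 *)
  have f0c x : `|f0 x| <= e / 2 + c * x ^+ 2.
    have := fl x 0; rewrite subr0 => /le_trans; apply.
    rewrite -[x ^+ 2]real_normK ?num_real//; move: `|x| => y.
    rewrite -subr_ge0 (_ : _ - _ = (e - L * y) ^+ 2 / (2 * e)).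
      by rewrite divr_ge0 ?sqr_ge0 ?mulr_ge0// ltW.
    by rewrite /c; field; rewrite gt_eqF.
  have cV : (fun N => c * V N) @ \oo --> (0 : R).
    by rewrite -(mulr0 c) -sigma0; exact: cvgMl_tmp.
  near=> N.
  have H : moment_estimate N by near: N.
  have := H _ _ _ _ cf0 f0B c0 f0c.
  rewrite /f0 (expectD _ (mX N) cf fB cc (fun _ => lexx _)) expect_cst distrC.
  move=> /le_trans; apply.
  have : c * V N <= e / 2 by near: N; move/cvgr_le : cV; exact.
  lra.
have sigma_gt0 : 0 < sigma2 by rewrite lt_neqAle eq_sym sigma_neq0.
apply: (cvg_in_distribution_of_lipschitz (nu := gauss_prob sigma2)) => // f L Bf fl fB.
apply: (gaussian_limit (V := sigma2 + 1) mX _ _ fl fB).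
  near=> N => k c Bk ck kB c0 kc.
  have H : moment_estimate N by near: N.
  have := H k 0 c Bk ck kB c0; rewrite add0r => /(_ _)/le_trans; apply.
    by move=> x; rewrite add0r.
  rewrite ler_wpM2l//; near: N; move/cvgr_le : V_cvg; apply.
  by rewrite ltrDl.
move=> k Lk A A0 kl ksupp kmean.
have ck := lipschitz_continuous kl.
have Lk0 : 0 <= Lk.
  by have := kl 1 0; rewrite subr0 normr1 mulr1; apply: le_trans.
have [h [h1 [h2 [K [C [B2 [hP hB2 hE]]]]]]] :=
  stein_solution sigma_gt0 A0 kl ksupp kmean.
have kB : exists Bk, forall x, `|k x| <= Bk.
  exists (Lk * (A + A)) => x; have [Ax|xA] := leP A `|x|.
    by rewrite ksupp// normr0 mulr_ge0// addr_ge0.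
  have kA : k A = 0 by rewrite ksupp// ger0_norm.
  have := kl x A; rewrite kA subr0 => /le_trans; apply; rewrite ler_wpM2l//.
  apply: le_trans (ler_normB _ _) _.
  by rewrite (ger0_norm A0) lerD2r ltW.
have [Bk {}kB] := kB.
have cv : (fun N => mu^-1 * (`|sN N - mu * sigma2| * B2
    + eta N * ((K + B2) * (2 + V N)))) @ \oo --> (0 : R).
  have : (fun N => mu^-1 * (`|sN N - mu * sigma2| * B2
    + eta N * ((K + B2) * (2 + V N)))) @ \oo --> mu^-1 *
      (`|mu * sigma2 - mu * sigma2| * B2 + 0 * ((K + B2) * (2 + sigma2))).
    apply: cvgMl_tmp; apply: cvgD.
      apply: cvgMr_tmp; apply: cvg_norm; apply: cvgB => //; exact: cvg_cst.
    apply: cvgM => //; apply: cvgMl_tmp; apply: cvgD => //; exact: cvg_cst.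
  by rewrite subrr normr0 !mul0r addr0 mulr0.
apply/norm_cvg0P; apply: (squeeze_cvgr _ (cvg_cst 0) cv).
apply: filterS stein_est => N H.
rewrite normr_ge0 /= mulrC ler_pdivlMr// mulrC.
exact: (H k h h1 h2 sigma2 K C B2 Bk).
Unshelve. all: by end_near. Qed.
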